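(* Let $\mu\in(0,\tfrac12]$ and let $(\bm{\eta}_t)_{t\ge 0}=\big((\eta_t(v))_{v\in\mathbb{Z}}\big)_{t\ge0}$ be the compass model on $\mathbb{Z}$ with parameter $\mu$, started from $(\eta_0(v))_{v\in\mathbb{Z}}$ i.i.d. uniformly distributed on $\mathcal{S}=(-1,1]$. Then for any fixed vertex $v\in\mathbb{Z}$, $$\mathbb{P}\Big(\lim_{t\to\infty}\eta_t(v)\text{ exists}\Big)=0,$$ where the limit is understood in the metric space $(\mathcal{S},d)$.
   Context: Opinion space: $\mathcal{S}=\mathbb{R}/2\mathbb{Z}$ (a circle of perimeter 2), identified with $(-1,1]$ by unique representatives; ''$x \pmod{\mathcal{S}}$'' denotes the representative of $x$ in $(-1,1]$. The metric is $d(x,y)=\min\{|x-y|,\,2-|x-y|\}$ for $x,y\in(-1,1]$, and $\mathcal{S}$ carries the corresponding circle topology. Compass model on $\mathbb{Z}$ with parameter $\mu\in(0,\tfrac12]$: the graph has vertex set $\mathbb{Z}$ and edges $e_v=\langle v,v+1\rangle$, $v\in\mathbb{Z}$. The state space is $\mathcal{S}^{\mathbb{Z}}$ with the product topology. The edges carry independent Poisson processes of rate 1, independent of the initial configuration $\bm{\eta}_0$. When the Poisson process of an edge $\langle u,v\rangle$ has an event at time $t$, only the opinions at $u$ and $v$ change: let $\delta\in(-1,1]$ be the representative of $\eta_{t-}(v)-\eta_{t-}(u)$. If $\delta\neq 1$, set $\sigma=\delta$; if $\delta=1$ (diametrically opposed opinions), let $\sigma\in\{-1,+1\}$ be chosen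 uniformly at random, independently of everything else. Then $\eta_t(u)=\eta_{t-}(u)+\mu\sigma \pmod{\mathcal{S}}$ and $\eta_t(v)=\eta_{t-}(v)-\mu\sigma\pmod{\mathcal{S}}$. *)

(* Defs.v *)
From HB Require Import structures.
From mathcomp Require Import all_boot all_order all_algebra.
From mathcomp Require Import all_classical all_reals all_analysis.

Set Implicit Arguments.
Unset Strict Implicit.
Unset Printing Implicit Defensive.
Import Order.TTheory GRing.Theory Num.Theory.
Import numFieldNormedType.Exports.
Local Open Scope classical_set_scope.
Local Open Scope ring_scope.

(* The circle R/2Z: its points are represented by the reals of `]-1, 1]. *)

(* [(x - 1) / 2] lies in `]n - 1, n] exactly when [x] lies in `]2n - 1, 2n + 1]. *)
Definition circle_repr (R : realType) (x : R) : R :=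
  x - 2 * (Num.ceil ((x - 1) / 2))%:~R.

Definition circle_dist (R : realType) (x y : R) : R :=
  Num.min `|x - y| (2 - `|x - y|).

Definition circle_cvg (R : realType) (F : set_system R) (f : R -> R) (l : R) :=
  l \in `]-1, 1] /\ circle_dist (f s) l @[s --> F] --> (0 : R).

Definition independent_systems (d : measure_display) (T : measurableType d)
    (R : realType) (P : probability T R) (I : choiceType)
    (G : I -> set_system T) : Prop :=
  (forall i, G i `<=` measurable) /\
  forall (J : seq I) (A : I -> set T), uniq J ->
    (forall i, i \in J -> G i (A i)) ->
    P (\bigcap_(i in [set` J]) A i) = (\prod_(i <- J) P (A i))%E.

(* sigma(X_i : i in D) *)
Definition sigma_generated (T : Type) (d' : measure_display)
    (T' : measurableType d') (I : Type) (D : set I) (X : I -> T -> T') :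
    set_system T :=
  <<s \bigcup_(i in D) preimage_set_system [set: T] (X i) measurable >>.

Definition independent_variables (d d' : measure_display)
    (T : measurableType d) (T' : measurableType d') (R : realType)
    (P : probability T R) (I : choiceType) (X : I -> T -> T') : Prop :=
  independent_systems P (fun i => sigma_generated [set i] X).

(* Paths are only constrained at nonnegative times, here and below. *)
Record poisson_process (d : measure_display) (T : measurableType d)
    (R : realType) (P : probability T R) (rate : R)
    (N : R -> {RV P >-> nat}) : Prop := PoissonProcess {
  poisson_path : \forall w \ae P,
    [/\ N 0 w = 0%N,
        forall s t : R, 0 <= s -> s <= t -> (N s w <= N t w)%N
      & forall t : R, 0 <= t -> \forall s \near t^'+, N s w = N t w];
  poisson_increment : forall (s t : R) (k : nat), 0 <= s -> s < t ->
    P [set w | (N t w - N s w)%N = k] = (poisson_pmf (rate * (t - s)) k)%:E;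
  poisson_independent_increments : forall t : nat -> R, 0 <= t 0%N ->
    {homo t : m n / (m <= n)%N >-> m <= n} ->
    independent_variables P (fun i w => (N (t i.+1) w - N (t i) w)%N)
}.

Definition jump_at (R : realType) (n : R -> nat) (t : R) : Prop :=
  0 < t /\ forall s : R, 0 <= s -> s < t -> (n s < n t)%N.

(* [x] and [y] are the opinions at the left and right end of an edge just before
   an event; [b] decides the direction if they are diametrically opposed. *)
Definition compass_direction (R : realType) (b : bool) (x y : R) : R :=
  let delta := circle_repr (y - x) in
  if delta == 1 then (-1) ^+ b else delta.

Definition compass_update (R : realType) (mu : R) (b : bool) (x y : R) : R * R :=
  let sigma := compass_direction b x y in
  (circle_repr (x + mu * sigma), circle_repr (y - mu * sigma)).

(* The sources of randomness: [None] is the initial configuration,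
   [Some (inl e)] the Poisson process of the edge <e, e + 1>, and
   [Some (inr (e, n))] the coin attached to the event of that edge at which its
   counting process reaches the value [n]. *)
Definition compass_sources (d : measure_display) (T : measurableType d)
    (R : realType) (P : probability T R) (N : int -> R -> {RV P >-> nat})
    (coin : int -> nat -> {RV P >-> bool}) (eta0 : int -> {RV P >-> R})
    (i : option (int + int * nat)) : set_system T :=
  match i with
  | None => sigma_generated [set: int] eta0
  | Some (inl e) => sigma_generated [set t : R | 0 <= t] (N e)
  | Some (inr (e, n)) => sigma_generated [set: unit] (fun=> coin e n)
  end.

(* The process is determined almost surely by these rules: almost surely no two
   edges have simultaneous events and, on every bounded time interval, the edges
   with no event cut Z into finite pieces. *)
Record compass_model (d : measure_display) (T : measurableType d)
    (R : realType) (P : probability T R) (mu : R)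
    (N : int -> R -> {RV P >-> nat}) (coin : int -> nat -> {RV P >-> bool})
    (eta : R -> int -> {RV P >-> R}) : Prop := CompassModel {
  compass_clock : forall e, poisson_process 1 (N e);
  compass_coin : forall e n, P [set w | coin e n w] = (2^-1)%:E;
  compass_independent :
    independent_systems P (compass_sources N coin (eta 0));
  compass_state : forall (t : R) (v : int) (w : T),
    0 <= t -> eta t v w \in `]-1, 1];
  compass_constant : \forall w \ae P, forall (v : int) (s t : R),
    0 <= s -> s <= t ->
    N (v - 1) s w = N (v - 1) t w -> N v s w = N v t w ->
    eta t v w = eta s v w;
  compass_jump : \forall w \ae P, forall (u : int) (t x y : R),
    jump_at (fun s => N u s w) t ->
    circle_cvg t^'- (fun s => eta s u w) x ->
    circle_cvg t^'- (fun s => eta s (u + 1) w) y ->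
    (eta t u w, eta t (u + 1) w) =
      compass_update mu (coin u (N u t w) w) x y
}.

Definition iid_uniform (d : measure_display) (T : measurableType d)
    (R : realType) (P : probability T R) (eta0 : int -> {RV P >-> R}) : Prop :=
  independent_variables P eta0 /\
  forall v (A : set R), measurable A ->
    distribution P (eta0 v) A = uniform_prob (gtrN (@ltr01 R)) A.

(* Main.v *)
Require Import Defs.
From HB Require Import structures.
From mathcomp Require Import all_boot all_order all_algebra.
From mathcomp Require Import all_classical all_reals all_analysis.
From mathcomp Require Import measurable_realfun ring lra zify.
Import Order.TTheory GRing.Theory Num.Theory.
Import numFieldNormedType.Exports.
Local Open Scope classical_set_scope.
Local Open Scope ring_scope.

(* Only integer times matter. If the opinion of [v] converges, its jumps tend to
   0; at each time the edge to [v + 1] has a fixed chance, independent of the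
   past, to be the only one near [v] to ring during the next unit of time, in
   which case [v] moves by [mu] times the discrepancy with [v + 1]. By
   conditional Borel-Cantelli the opinion of [v + 1] therefore has the same
   limit, and by induction so do those of all [v + n]. By translation invariance
   the speed of convergence is uniform in [n], so at some fixed time [K] the
   opinions at [v] and [v + n] are close with a probability bounded below
   uniformly in [n]. But up to a small error the opinion of a vertex at time [K]
   only depends on a bounded neighbourhood, and rotating the initial opinions
   near [v] alone preserves the law: for large [n], being [e]-close has
   probability of order [e]. Contradiction.

   Laws are computed with a cellular automaton on a time mesh of step [1/(m+1)],
   which agrees with the model at integer times as soon as no two events of
   the edges near [v] fall in one cell, and an edge without events on either
   side of [v] screens off the rest of the line. *)

Set Implicit Arguments.
Unset Strict Implicit.
Unset Printing Implicit Defensive.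

(** * Arithmetic of the circle *)

(** The model is characterised by its rules rather than constructed, so its law is reached by
    showing that [eta] near a vertex agrees with an explicit function of the sources. The infinite
    line has no first event from which a recursion could start. The automaton has no such problem:
    it updates all vertices at once and reads one neighbour on each side per cell, so its dependence
    on the initial opinions is exactly local, and shifts and rotations act on it by identities. The
    mesh also turns the clocks into countably many independent increments, the form in which
    [poisson_independent_increments] provides independence. The price is an error in probability,
    uniform in the vertex but only over a bounded horizon. Every statement about all times is
    therefore first proved for finitely many, with an estimate that survives the limit: oscillation
    through [steady_upto], Borel-Cantelli through [missed], whose bound does not depend on the
    number of steps. *)

Definition circle_norm (R : realType) (x : R) : R := `|circle_repr x|.

Section circle.
Context {R : realType}.
Implicit Types x y z c : R.

Lemma circle_repr_itv x : -1 < circle_repr x <= 1.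
Proof.
rewrite /circle_repr; have := ceil_itv ((x - 1) / 2).
by rewrite intrB => /andP[h1 h2]; apply/andP; split; lra.
Qed.

Lemma circle_repr_eq x y (k : int) :
  -1 < y <= 1 -> y = x - 2 * k%:~R -> circle_repr x = y.
Proof.
move=> /andP[y0 y1] yE; rewrite /circle_repr yE; congr (_ - 2 * _%:~R).
by (apply: ceil_def; rewrite intrB; apply/andP; split; lra).
Qed.

Lemma circle_repr_id x : -1 < x <= 1 -> circle_repr x = x.
Proof. by move=> x1; apply: (@circle_repr_eq _ _ 0) => //; rewrite mulr0 subr0. Qed.

Lemma circle_reprE x : exists k : int, circle_repr x = x - 2 * k%:~R.
Proof. by eexists. Qed.

Lemma circle_repr_shift x (k : int) : circle_repr (x + 2 * k%:~R) = circle_repr x.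
Proof.
have [j jE] := circle_reprE x.
apply: (@circle_repr_eq _ _ (j + k)); first exact: circle_repr_itv.
by rewrite jE intrD; lra.
Qed.

Lemma circle_reprD x y : circle_repr (circle_repr x + y) = circle_repr (x + y).
Proof.
have [j ->] := circle_reprE x.
by rewrite -[RHS](circle_repr_shift _ (- j)) mulrNz; congr circle_repr; lra.
Qed.

Lemma circle_reprB x y c :
  circle_repr (circle_repr (x + c) - circle_repr (y + c)) = circle_repr (x - y).
Proof.
rewrite circle_reprD; have [j ->] := circle_reprE (y + c).
by rewrite -[RHS](circle_repr_shift _ j); congr circle_repr; lra.
Qed.

(** [circle_norm x] is the distance from [x] to 2Z, attained at the representative. This minimality
    yields the triangle inequality and symmetry by a choice of lattice point. *)
Lemma circle_norm_le x (k : int) : circle_norm x <= `|x - 2 * k%:~R|.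
Proof.
rewrite /circle_norm -(circle_repr_shift x (- k)) mulrNz mulrN.
set y := x - _; have r1 : `|circle_repr y| <= 1.
  by have /andP[r1 r2] := circle_repr_itv y; rewrite ler_norml (ltW r1).
have [y1|y1] := lerP `|y| 1.
  (* The point -1 is represented by 1, of the same absolute value; on the rest of [-1, 1]
     [circle_repr] is the identity. *)
  have [yE|y2] := eqVneq y (-1); first by rewrite {2}yE normrN1.
  rewrite circle_repr_id// lt_def y2 /=.
  by move: y1; rewrite ler_norml.
exact: le_trans r1 (ltW y1).
Qed.

Lemma circle_norm_ge0 x : 0 <= circle_norm x. Proof. exact: normr_ge0. Qed.

Lemma circle_norm_small x : `|x| <= 1 -> circle_norm x = `|x|.
Proof.
have [->|x2] := eqVneq x (-1).
  move=> _; rewrite /circle_norm (@circle_repr_eq _ 1 (-1)) ?normrN1 ?normr1//.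
  by apply/andP; split; lra.
  by rewrite mulrNz; lra.
move=> x1; rewrite /circle_norm circle_repr_id// lt_def x2 /=.
by move: x1; rewrite ler_norml.
Qed.

Lemma circle_normD x y : circle_norm (x + y) <= circle_norm x + circle_norm y.
Proof.
rewrite {2 3}/circle_norm; have [j ->] := circle_reprE x.
have [k ->] := circle_reprE y.
apply: le_trans (circle_norm_le _ (j + k)) _.
apply: le_trans (ler_normD _ _); rewrite le_eqVlt; apply/orP; left.
by apply/eqP; congr `|_|; rewrite intrD; lra.
Qed.

Lemma circle_normN x : circle_norm (- x) = circle_norm x.
Proof.
have H z : circle_norm (- z) <= circle_norm z.
  rewrite {2}/circle_norm; have [j ->] := circle_reprE z.
  apply: le_trans (circle_norm_le _ (- j)) _.
  rewrite -normrN le_eqVlt; apply/orP; left.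
  by apply/eqP; congr `|_|; rewrite mulrNz; lra.
by apply/eqP; rewrite eq_le H -{1}(opprK x) H.
Qed.

Lemma circle_normC x y : circle_norm (x - y) = circle_norm (y - x).
Proof. by rewrite -circle_normN opprB. Qed.

Lemma circle_norm_triangle z x y :
  circle_norm (x - y) <= circle_norm (x - z) + circle_norm (z - y).
Proof. by have := circle_normD (x - z) (z - y); rewrite addrA subrK. Qed.

Lemma circle_norm_reprD x y : circle_norm (circle_repr x + y) = circle_norm (x + y).
Proof. by rewrite /circle_norm circle_reprD. Qed.

Lemma circle_distE x y : x \in `]-1, 1] -> y \in `]-1, 1] ->
  circle_dist x y = circle_norm (x - y).
Proof.
rewrite !in_itv /= => /andP[x0 x1] /andP[y0 y1].
rewrite /circle_dist; have [h|h] := lerP `|x - y| 1.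
  by rewrite circle_norm_small// minEle ifT//; lra.
rewrite minEle ifF; last by apply/negbTE; rewrite -ltNge; lra.
move: h; have [xy|xy] := lerP 0 (x - y).
  rewrite ger0_norm// => h.
  rewrite /circle_norm (@circle_repr_eq _ (x - y - 2) 1); last 2 first.
  - by apply/andP; split; lra.
  - by rewrite mulr1.
  by rewrite ltr0_norm; lra.
rewrite ltr0_norm// => h.
rewrite /circle_norm (@circle_repr_eq _ (x - y + 2) (-1)); last 2 first.
- by apply/andP; split; lra.
- by rewrite mulrNz; lra.
by rewrite gtr0_norm; lra.
Qed.

Lemma compass_direction_norm b x y :
  `|compass_direction b x y| = circle_norm (x - y).
Proof.
rewrite circle_normC /compass_direction /circle_norm; case: ifP => // /eqP ->.
by case: b; rewrite ?expr1 ?expr0 ?normrN ?normr1.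
Qed.

(** The interaction sees only the difference of the opinions, hence commutes with rotations; this is
    what carries rotated initial opinions through the automaton. *)
Lemma compass_direction_shift b x y c :
  compass_direction b (circle_repr (x + c)) (circle_repr (y + c)) =
  compass_direction b x y.
Proof. by rewrite /compass_direction circle_reprB. Qed.

Lemma compass_update_shift mu b x y c :
  compass_update mu b (circle_repr (x + c)) (circle_repr (y + c)) =
  (circle_repr ((compass_update mu b x y).1 + c),
   circle_repr ((compass_update mu b x y).2 + c)).
Proof.
rewrite /compass_update /= compass_direction_shift !circle_reprD.
by congr (circle_repr _, circle_repr _); ring.
Qed.

(** A displacement of length at most [mu <= 1/2] does not wrap around the circle, so its norm is its
    length. For opposed opinions both signs have absolute value 1, the discrepancy itself, so the
    coin does not matter. *)
Lemma compass_update_move mu b x y : 0 < mu <= 2^-1 ->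
  circle_norm ((compass_update mu b x y).1 - x) = mu * circle_norm (x - y).
Proof.
move=> /andP[mu0 mu1]; rewrite /compass_update /= circle_norm_reprD.
rewrite addrC addKr circle_norm_small normrM (gtr0_norm mu0) compass_direction_norm//.
have : circle_norm (x - y) <= 1.
  by have := circle_repr_itv (x - y); rewrite /circle_norm ler_norml => /andP[/ltW-> ->].
have := circle_norm_ge0 (x - y); set d := circle_norm _ => d0 d1.
by nra.
Qed.

End circle.

(** * Probabilities as reals, and laws of families of variables *)

(** Real-valued, so that linear arithmetic closes the estimates. *)
Definition Pr (d : measure_display) (T : measurableType d) (R : realType)
  (P : probability T R) (A : set T) : R := fine (P A).

Section real_probability.
Context (d : measure_display) (T : measurableType d) (R : realType)
  (P : probability T R).
Implicit Types A B : set T.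

Lemma PrE A : measurable A -> P A = (Pr P A)%:E.
Proof. by move=> mA; rewrite /Pr fineK// fin_num_measure. Qed.

Lemma Pr_ge0 A : 0 <= Pr P A. Proof. exact: fine_ge0. Qed.

Lemma Pr_le A B : measurable A -> measurable B -> A `<=` B -> Pr P A <= Pr P B.
Proof.
by move=> mA mB AB; rewrite -lee_fin -!PrE//; apply: le_measure; rewrite ?inE.
Qed.

Lemma PrT : Pr P setT = 1.
Proof. by rewrite /Pr probability_setT. Qed.

Lemma Pr0 : Pr P set0 = 0.
Proof. by rewrite /Pr measure0. Qed.

Lemma PrU A B : measurable A -> measurable B -> A `&` B = set0 ->
  Pr P (A `|` B) = Pr P A + Pr P B.
Proof.
move=> mA mB AB; apply: EFin_inj; rewrite EFinD -!PrE//; last exact: measurableU.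
exact: measureU.
Qed.

Lemma Pr_split B A : measurable A -> measurable B ->
  Pr P A = Pr P (A `&` B) + Pr P (A `\` B).
Proof.
move=> mA mB; rewrite -PrU; last 3 first.
- exact: measurableI.
- exact: measurableD.
- by apply/seteqP; split => x // [[_ Bx]] [_]; exact.
congr Pr; apply/seteqP; split => x; last by case => -[].
by move=> Ax; case: (pselect (B x)) => Bx; [left|right].
Qed.

Lemma PrU_le A B : measurable A -> measurable B ->
  Pr P (A `|` B) <= Pr P A + Pr P B.
Proof.
move=> mA mB; rewrite (_ : A `|` B = A `|` (B `\` A)); last first.
  by apply/seteqP; split => x /=; have [] := pselect (A x); tauto.
rewrite PrU ?lerD2l//; last 2 first.
- exact: measurableD.
- by apply/seteqP; split => x //= -[? []].
by apply: Pr_le; [exact: measurableD| |move=> x []].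
Qed.

Lemma Pr_bigU_le (I : Type) (s : seq I) (A : I -> set T) :
  (forall i, measurable (A i)) ->
  Pr P (\big[setU/set0]_(i <- s) A i) <= \sum_(i <- s) Pr P (A i).
Proof.
move=> mA; elim: s => [|i s ih]; first by rewrite !big_nil Pr0.
rewrite !big_cons; apply: le_trans (PrU_le _ _) _ => //.
  exact: bigsetU_measurable.
by rewrite lerD2l.
Qed.

Lemma Pr_bigU (I : choiceType) (s : seq I) (A : I -> set T) :
  uniq s -> (forall i, measurable (A i)) ->
  (forall i j w, A i w -> A j w -> i = j) ->
  \sum_(i <- s) Pr P (A i) = Pr P (\big[setU/set0]_(i <- s) A i).
Proof.
move=> + mA dA; elim: s => [|i s ih]; first by rewrite !big_nil Pr0.
rewrite !big_cons /= => /andP[nis us]; rewrite ih// PrU//.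
  exact: bigsetU_measurable.
apply/seteqP; split => x //; rewrite -bigcup_seq => -[Ax [j js Ajx]].
by move: nis; rewrite (dA _ _ _ Ax Ajx) js.
Qed.

Lemma Pr_cvg_up (F : nat -> set T) :
  (forall i, measurable (F i)) -> nondecreasing_seq F ->
  Pr P (F n) @[n --> \oo] --> Pr P (\bigcup_n F n).
Proof.
move=> mF nF; apply: fine_cvg; rewrite -[in X in _ --> X]PrE; last exact: bigcupT_measurable.
by apply: nondecreasing_cvg_mu => //; exact: bigcupT_measurable.
Qed.

Lemma Pr_cvg_down (F : nat -> set T) :
  (forall i, measurable (F i)) -> nonincreasing_seq F ->
  Pr P (F n) @[n --> \oo] --> Pr P (\bigcap_n F n).
Proof.
move=> mF nF; apply: fine_cvg; rewrite -[in X in _ --> X]PrE; last exact: bigcapT_measurable.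
apply: nonincreasing_cvg_mu => //; last exact: bigcapT_measurable.
by have := fin_num_measure P _ (mF 0%N); rewrite ge0_fin_numE.
Qed.

(** A measurable null set can join the other exceptional events in a union bound. *)
Lemma ae_null (Q : T -> Prop) : (\forall w \ae P, Q w) ->
  exists2 B : set T, measurable B /\ Pr P B = 0 & forall w, ~ B w -> Q w.
Proof.
move=> [B [mB B0 QB]]; exists B; first by rewrite /Pr B0.
by move=> w nB; apply: contrapT => nQ; apply/nB/QB.
Qed.

End real_probability.

(** All functions on [I] are kept and only the coordinates in [J] are constrained. Sigma-algebras
    for different [J] thus live on one space, and measurability for [J] encodes that an event is
    determined by these coordinates. *)
Definition cylinders (I : choiceType) (R : realType) (J : set I) :
  set_system (I -> R) :=
  [set D | exists (s : seq I) (A : I -> set R),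
    [/\ uniq s, forall i, i \in s -> J i, forall i, measurable (A i)
      & D = [set f | forall i, i \in s -> A i (f i)]]].

Section cylinders.
Context (I : choiceType) (R : realType).
Implicit Type J : set I.

Local Notation space J := (g_sigma_algebraType (@cylinders I R J)).

Lemma cylindersT J : cylinders J [set: I -> R].
Proof.
by exists [::], (fun=> setT); split => //; apply/seteqP; split.
Qed.

Lemma cylinders_setI J : setI_closed (@cylinders I R J).
Proof.
move=> _ _ [s [A [us sJ mA ->]]] [t [B [ut tJ mB ->]]].
(* The sets [A i] are arbitrary off [s], and [B i] off [t], hence the defaults [setT]. *)
exists (undup (s ++ t)), (fun i => (if i \in s then A i else setT) `&`
  (if i \in t then B i else setT)); split.
- exact: undup_uniq.
- by move=> i; rewrite mem_undup mem_cat => /orP[/sJ|/tJ].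
- by move=> i; apply: measurableI; case: ifP.
- apply/seteqP; split => f /=.
    move=> [sf tf] i; rewrite mem_undup mem_cat => /orP[it|it].
      by rewrite it; split; [exact: sf|case: ifP => //; exact: tf].
    by rewrite it; split; [case: ifP => //; exact: sf|exact: tf].
  move=> stf; split => i it; have := stf i; rewrite mem_undup mem_cat it ?orbT.
    by case.
  by move=> [].
Qed.

Lemma measurable_coordinate J (i : I) : J i ->
  measurable_fun [set: space J] (fun f : space J => f i).
Proof.
move=> Ji _ A mA; rewrite setTI; apply: sub_sigma_algebra.
exists [:: i], (fun=> A); split => //.
  by move=> j; rewrite inE => /eqP ->.
apply/seteqP; split => f /=; first by move=> Af j; rewrite inE => /eqP ->.
by apply; rewrite inE.
Qed.

Context (d : measure_display) (T : measurableType d) (P : probability T R).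
Implicit Types X Y : I -> T -> R.

Lemma measurable_family J X (D : set (space J)) :
  (forall i, measurable_fun setT (X i)) -> measurable D ->
  measurable [set w | D (fun i => X i w)].
Proof.
move=> mX mD.
suff : measurable_fun setT (fun w => (fun i => X i w) : space J).
  by move=> /(_ measurableT _ mD); rewrite setTI.
apply: (@measurability _ _ T (space J) setT _ (@cylinders I R J)) => //.
move=> _ [_ [s [A [us sJ mA ->]] <-]].
rewrite setTI (_ : _ @^-1` _ = \bigcap_(i in [set` s]) (X i @^-1` A i)).
  rewrite bigcap_seq; apply: bigsetI_measurable => i _.
  by rewrite -[X in measurable X]setTI; exact: mX.
by apply/seteqP; split.
Qed.

(** One statement for two purposes: [B = setT] and [c = 1] compare the laws of two families, while
    [X = Y] with [c] the probability of [B] expresses that [B] is independent of the family. *)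
Lemma pi_lambda_family J X Y (B : set T) (c : R) : 0 <= c ->
  (forall i, measurable_fun setT (X i)) ->
  (forall i, measurable_fun setT (Y i)) -> measurable B ->
  (forall D, cylinders J D -> Pr P ([set w | D (fun i => X i w)] `&` B) =
    c * Pr P [set w | D (fun i => Y i w)]) ->
  forall D : set (space J), measurable D ->
    Pr P ([set w | D (fun i => X i w)] `&` B) =
    c * Pr P [set w | D (fun i => Y i w)].
Proof.
move=> c0 mX mY mB GE.
have mXB (D : set (space J)) : measurable D ->
    measurable ([set w | D (fun i => X i w)] `&` B).
  by move=> mD; apply: measurableI => //; exact: measurable_family.
have mYD (D : set (space J)) : measurable D -> measurable [set w | D (fun i => Y i w)].
  exact: measurable_family.
(* The total masses agree; the complement step subtracts from them. *)
have ET := GE _ (cylindersT J).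
apply: (@dynkin_induction _ (space J) (@cylinders I R J)) => //.
- exact: cylinders_setI.
- move=> D mD IH; have mT : measurable [set: space J] by [].
  have e1 := @Pr_split _ _ _ P [set w | D (fun i => X i w)] _ (mXB _ mT) (measurable_family mX mD).
  have e2 := @Pr_split _ _ _ P [set w | D (fun i => Y i w)] _ (mYD _ mT) (mYD _ mD).
  move: e1 e2; rewrite ET.
  rewrite (_ : ([set w | [set: space J] (fun i => X i w)] `&` B) `&` [set w | D (fun i => X i w)] =
    [set w | D (fun i => X i w)] `&` B); last by apply/seteqP; split => w /=; tauto.
  rewrite (_ : ([set w | [set: space J] (fun i => X i w)] `&` B) `\` [set w | D (fun i => X i w)] =
    [set w | (~` D) (fun i => X i w)] `&` B); last by apply/seteqP; split => w /=; tauto.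
  rewrite (_ : [set w | [set: space J] (fun i => Y i w)] `&` [set w | D (fun i => Y i w)] =
    [set w | D (fun i => Y i w)]); last by apply/seteqP; split => w /=; tauto.
  rewrite (_ : [set w | [set: space J] (fun i => Y i w)] `\` [set w | D (fun i => Y i w)] =
    [set w | (~` D) (fun i => Y i w)]); last by apply/seteqP; split => w /=; tauto.
  by rewrite IH => e1 e2; move: e1; rewrite e2 mulrDr; lra.
- move=> F mF tF IH; apply: EFin_inj; rewrite EFinM -!PrE; last 2 first.
  + by apply: mYD; exact: bigcupT_measurable.
  + by apply: mXB; exact: bigcupT_measurable.
  have h (Z : I -> T -> R) : [set w | (\bigcup_k F k) (fun i => Z i w)] =
    \bigcup_k [set w | F k (fun i => Z i w)] by [].
  have tZ (Z : I -> T -> R) : trivIset setT (fun k => [set w | F k (fun i => Z i w)]).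
    move=> i j _ _ [w [/= Fi Fj]]; apply: tF => //; exists (fun i => Z i w); split => //.
  rewrite !h setI_bigcupl !measure_semi_bigcup//.
  + rewrite -nneseriesZl//; apply: eq_eseriesr => k _.
    rewrite [LHS](PrE P (mXB _ (mF k))) IH EFinM; congr (_ * _)%E.
    exact/esym/PrE/mYD.
  + by move=> k; exact: mYD.
  + by apply: bigcupT_measurable => k; exact: mYD.
  + by move=> k; exact: mXB.
  + by apply: trivIset_setIr.
  + by apply: bigcupT_measurable => k; exact: mXB.
Qed.

Definition jointly_independent X : Prop :=
  (forall i, measurable_fun setT (X i)) /\
  forall (s : seq I) (A : I -> set R), uniq s -> (forall i, measurable (A i)) ->
    Pr P [set w | forall i, i \in s -> A i (X i w)] =
    \prod_(i <- s) Pr P (X i @^-1` A i).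

Lemma eq_law X Y : jointly_independent X -> jointly_independent Y ->
  (forall i A, measurable A -> Pr P (X i @^-1` A) = Pr P (Y i @^-1` A)) ->
  forall D : set (space setT), measurable D ->
    Pr P [set w | D (fun i => X i w)] = Pr P [set w | D (fun i => Y i w)].
Proof.
move=> [mX iX] [mY iY] XY D mD.
rewrite -[LHS](congr1 (Pr P) (setIT _)) -[RHS]mul1r.
apply: pi_lambda_family => // _ [s [A [us _ mA ->]]].
by rewrite setIT mul1r iX// iY//; apply: eq_bigr => i _; exact: XY.
Qed.

End cylinders.

(** * Independence of the sources of randomness *)

Section transport.
Context (R : realType) (d : measure_display) (T : measurableType d)
  (P : probability T R) (I : choiceType).

Lemma jointly_independent_reindex (X : I -> T -> R) (phi psi : I -> I) :
  cancel phi psi -> jointly_independent P X ->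
  jointly_independent P (fun i => X (phi i)).
Proof.
move=> phiK [mX iX]; split=> [i|s A us mA]; first exact: mX.
have := iX [seq phi i | i <- s] (fun j => A (psi j)) _ _.
rewrite map_inj_uniq; last exact: can_inj phiK.
move=> /(_ us (fun j => mA _)); rewrite big_map.
under eq_bigr do rewrite phiK.
move=> <-; congr Pr; apply/seteqP; split => w /= H j.
  by move=> /mapP[i si ->]; rewrite phiK; exact: H.
by move=> js; have := H (phi j); rewrite phiK; apply; exact: map_f.
Qed.

Lemma jointly_independent_comp (X : I -> T -> R) (g : I -> R -> R) :
  (forall i, measurable_fun setT (g i)) -> jointly_independent P X ->
  jointly_independent P (fun i => g i \o X i).
Proof.
move=> mg [mX iX]; split=> [i|s A us mA]; first exact: measurableT_comp.
rewrite (iX s (fun i => g i @^-1` A i))// => i.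
by rewrite -[X in measurable X]setTI; exact: mg.
Qed.

End transport.

Section grouping.
Context (R : realType) (d : measure_display) (T : measurableType d)
  (P : probability T R).
Context (I K : choiceType) (X : I -> T -> R) (src : I -> K) (G : K -> set_system T).
Hypothesis iG : independent_systems P G.

Lemma prod_by_class (s : seq I) (F : I -> R) :
  \prod_(i <- s) F i =
  \prod_(r <- undup (map src s)) \prod_(i <- s | src i == r) F i.
Proof.
rewrite (exchange_big_dep xpredT)//= big_seq [RHS]big_seq; apply: eq_bigr => i si.
rewrite -big_filter.
rewrite (_ : [seq _ <- _ | _] = [:: src i]) ?big_seq1//.
rewrite (eq_filter (a2 := pred1 (src i))); last by move=> r; rewrite /= eq_sym.
by rewrite filter_pred1_uniq ?undup_uniq// mem_undup map_f.
Qed.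

(** Independence in two levels: the constraints on variables of one source form a single event of
    that source, and distinct sources are independent; inside one source the product formula is the
    last premise. *)
Lemma independent_by_class :
  (forall i, measurable_fun setT (X i)) ->
  (forall r (s : seq I) (A : I -> set R), (forall i, measurable (A i)) ->
    G r [set w | forall i, i \in s -> src i = r -> A i (X i w)]) ->
  (forall r (s : seq I) (A : I -> set R), uniq s -> (forall i, measurable (A i)) ->
    Pr P [set w | forall i, i \in s -> src i = r -> A i (X i w)] =
    \prod_(i <- s | src i == r) Pr P (X i @^-1` A i)) ->
  jointly_independent P X.
Proof.
move=> mX H1 H2; split => // s A us mA.
pose E r := [set w | forall i, i \in s -> src i = r -> A i (X i w)].
have := iG.2 (undup (map src s)) E (undup_uniq _) (fun r _ => H1 r s A mA).
rewrite (_ : \bigcap_(_ in _) _ = [set w | forall i, i \in s -> A i (X i w)]); last first.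
  apply/seteqP; split => w /=.
    move=> H i si; apply: (H (src i)) => //=.
    by rewrite mem_undup map_f.
  by move=> H r _ i si _; exact: H.
move=> PE; rewrite /Pr PE prod_by_class.
rewrite (eq_bigr (fun r => (Pr P (E r))%:E)); last first.
  by move=> r _; rewrite PrE//; apply: iG.1; exact: H1.
rewrite prodEFin /=; apply: eq_bigr => r _; exact: H2.
Qed.

End grouping.

Section one_class.
Context (R : realType) (d : measure_display) (T : measurableType d)
  (P : probability T R).
Context (I K : choiceType) (X : I -> T -> R) (emb : K -> I) (prj : I -> option K)
  (G : K -> set_system T).
Hypothesis prjK : ocancel prj emb.
Hypothesis embK : pcancel emb prj.
Hypothesis iG : independent_systems P G.

(** [emb] enumerates the variables of one class, and its partial inverse [prj] extracts from [s]
    those that belong to it. *)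
Lemma independent_class (Q : I -> bool) (s : seq I) (A : I -> set R) :
  (forall i, Q i = isSome (prj i)) ->
  (forall k, G k (X (emb k) @^-1` A (emb k))) -> uniq s ->
  Pr P [set w | forall i, i \in s -> Q i -> A i (X i w)] =
  \prod_(i <- s | Q i) Pr P (X i @^-1` A i).
Proof.
move=> QE GA us.
have := iG.2 (pmap prj s) (fun k => X (emb k) @^-1` A (emb k)) (pmap_uniq prjK us)
  (fun k _ => GA k).
rewrite (_ : \bigcap_(_ in _) _ =
    [set w | forall i, i \in s -> Q i -> A i (X i w)]); last first.
  apply/seteqP; split => w /=.
    move=> H i si; rewrite QE; case E : (prj i) => [k|//] _.
    have := prjK i; rewrite E /= => <-; apply: (H k) => /=.
    by rewrite mem_pmap -E map_f.
  move=> H k /=; rewrite mem_pmap => /mapP[i si kE].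
  have := prjK i; rewrite -kE /= => ->; apply: H => //.
  by rewrite QE -kE.
move=> PE; rewrite /Pr PE.
rewrite (eq_bigr (fun k => (Pr P (X (emb k) @^-1` A (emb k)))%:E)); last first.
  by move=> k _; rewrite PrE//; exact: iG.1.
rewrite prodEFin /= -(big_map emb xpredT (fun i => Pr P (X i @^-1` A i))).
by rewrite pmap_filter// big_filter; apply: eq_bigl => i; rewrite QE.
Qed.

End one_class.

(* initial opinions, increments [(e, i)] of the clock of [e] over the cell [i], coins *)
Local Notation source_index := (int + int * nat + int * nat)%type.

Section sources.
Context (R : realType) (d : measure_display) (T : measurableType d)
  (P : probability T R) (mu : R)
  (N : int -> R -> {RV P >-> nat}) (coin : int -> nat -> {RV P >-> bool})
  (eta : R -> int -> {RV P >-> R}).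
Hypothesis heta : compass_model mu N coin eta.
Hypothesis heta0 : iid_uniform (eta 0).

(** Counts and coins are cast to reals, so that a single real family carries all the randomness. The
    times [t] stay free because several meshes are used. *)
Definition source (t : nat -> R) (x : source_index) (w : T) : R :=
  match x with
  | inl (inl u) => eta 0 u w
  | inl (inr (e, i)) => (N e (t i.+1) w - N e (t i) w)%N%:R
  | inr (e, n) => (coin e n w)%:R
  end.

Definition source_class (x : source_index) : option (int + int * nat) :=
  match x with
  | inl (inl u) => None
  | inl (inr (e, i)) => Some (inl e)
  | inr (e, n) => Some (inr (e, n))
  end.

Lemma sigma_generated_measurable_fun (d' : measure_display) (T' : measurableType d')
    (J : Type) (D : set J) (Y : J -> T -> T') (j : J) : D j ->
  measurable_fun [set: g_sigma_algebraType (\bigcup_(i in D)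
    preimage_set_system [set: T] (Y i) measurable)] (Y j).
Proof.
move=> Dj _ A mA; apply: sub_sigma_algebra; exists j => //.
by exists A.
Qed.

Lemma measurable_fun_nat2 (d' : measure_display) (T' : measurableType d')
    (f g : T' -> nat) (h : nat -> nat -> R) :
  measurable_fun setT f -> measurable_fun setT g ->
  measurable_fun setT (fun w => h (f w) (g w)).
Proof.
move=> mf mg _ A mA; rewrite setTI.
rewrite (_ : _ @^-1` A = \bigcup_m \bigcup_n (if `[< A (h m n) >] then
   f @^-1` [set m] `&` g @^-1` [set n] else set0)); last first.
  apply/seteqP; split => w /=.
    by move=> Aw; exists (f w) => //; exists (g w) => //; case: asboolP.
  by move=> [m _ [n _]]; case: asboolP => // Amn [/= -> ->].
apply: bigcupT_measurable => m; apply: bigcupT_measurable => n.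
case: ifP => // _; apply: measurableI.
  by rewrite -[X in measurable X]setTI; exact: mf.
by rewrite -[X in measurable X]setTI; exact: mg.
Qed.

Lemma source_class_measurable (t : nat -> R) r (i : source_index) A :
  (forall n, 0 <= t n) -> measurable A -> source_class i = r ->
  compass_sources N coin (eta 0) r (source t i @^-1` A).
Proof.
move=> t0 mA <-; case: i => [[u|[e i]]|[e n]] /=.
- have /(_ measurableT _ mA) := @sigma_generated_measurable_fun _ _ int setT
    (fun u => eta 0 u : T -> R) u Logic.I.
  by rewrite setTI.
- have h := @measurable_fun_nat2 _ (g_sigma_algebraType (\bigcup_(s in [set s : R | 0 <= s])
    preimage_set_system [set: T] (N e s) measurable)) (N e (t i.+1)) (N e (t i))
    (fun a b => (a - b)%N%:R).
  have {h} := h _ _ measurableT _ mA; rewrite setTI; apply.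
    exact: (@sigma_generated_measurable_fun _ _ _ [set s : R | 0 <= s]
      (fun s => N e s : T -> nat) _ (t0 _)).
  exact: (@sigma_generated_measurable_fun _ _ _ [set s : R | 0 <= s]
      (fun s => N e s : T -> nat) _ (t0 _)).
- apply: sub_sigma_algebra; exists tt => //.
  by exists [set b : bool | A (b%:R)] => //; rewrite setTI.
Qed.

Lemma source_independent (t : nat -> R) : 0 <= t 0%N ->
  {homo t : m n / (m <= n)%N >-> m <= n} -> jointly_independent P (source t).
Proof.
move=> t0 tm.
have tn n : 0 <= t n by apply: le_trans t0 _; exact: tm.
have iG := compass_independent heta.
apply: (independent_by_class (src := source_class) iG).
- move=> i _ A mA; rewrite setTI; apply: (iG.1 (source_class i)).
  exact: source_class_measurable.
- move=> r s A mA.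
  rewrite (_ : [set w | _] = \big[setI/setT]_(i <- s | source_class i == r)
     (source t i @^-1` A i)); last first.
    rewrite -bigcap_seq_cond; apply/seteqP; split => w /=.
      by move=> H i /= /andP[si /eqP ir]; exact: H.
    by move=> H i si /eqP ir; apply: H; rewrite /= si ir.
  have key i : source_class i = r ->
    compass_sources N coin (eta 0) r (source t i @^-1` A i).
    exact: source_class_measurable.
  case: r key => [[e|[e n]]|] key.
  + apply: (@bigsetI_measurable _ (g_sigma_algebraType (\bigcup_(s in [set s : R | 0 <= s])
      preimage_set_system [set: T] (N e s) measurable))) => i /eqP; exact: key.
  + apply: (@bigsetI_measurable _ (g_sigma_algebraType (\bigcup_(s in [set: unit])
      preimage_set_system [set: T] (coin e n) measurable))) => i /eqP; exact: key.
  + apply: (@bigsetI_measurable _ (g_sigma_algebraType (\bigcup_(s in [set: int])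
      preimage_set_system [set: T] (eta 0 s) measurable))) => i /eqP; exact: key.
- move=> r s A us mA.
  rewrite (_ : [set w | _] = [set w | forall i, i \in s -> source_class i == r ->
     A i (source t i w)]); last first.
    by apply/seteqP; split => w /= H i si; [move=> /eqP|move/eqP]; exact: H.
  case: r => [[e|[e n]]|].
  + apply: (independent_class (K := nat) (emb := fun i => inl (inr (e, i)))
      (prj := fun x => if x is inl (inr (e', i)) then
        if e' == e then Some i else None else None)
      (G := fun i => sigma_generated [set i]
        (fun i w => (N e (t i.+1) w - N e (t i) w)%N))) => //.
    * by move=> [[u|[e' i]]|[e' n]] //=; case: eqP => //= ->.
    * exact: (poisson_independent_increments (compass_clock heta e)).
    * by move=> [[u|[e' i]]|[e' n]] //=; rewrite -[_ == _ :> option _]/(e' == e); case: eqP.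
    * move=> i; apply: sub_sigma_algebra; exists i => //.
      by exists [set k | A (inl (inr (e, i))) (k%:R)] => //; rewrite setTI.
  + apply: (independent_class (K := unit) (emb := fun i => inr (e, n))
      (prj := fun x => if x is inr (e', n') then
        if (e', n') == (e, n) then Some tt else None else None)
      (G := fun _ => sigma_generated [set: unit] (fun=> coin e n))) => //.
    * by move=> [[u|[e' i]]|[e' n']] //=; case: eqP => //= -> .
    * split; first by move=> _; exact: (iG.1 (Some (inr (e, n)))).
      (* A duplicate-free list over [unit] has at most one element, so the product formula is
         trivial for a single coin. *)
      move=> [|[] [|[] J]] B //= _ GB.
        by rewrite big_nil (_ : \bigcap_(_ in _) _ = setT) ?probability_setT//; apply/seteqP; split.
      by rewrite big_seq1; congr (P _); apply/seteqP; split => w /=; [apply|move=> Bw []].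
    * move=> [[u|[e' i]]|[e' n']] //=.
      by rewrite -[_ == _ :> option _]/((e', n') == (e, n)); case: eqP.
    * move=> i; apply: sub_sigma_algebra; exists tt => //.
      by exists [set k : bool | A (inr (e, n)) (k%:R)] => //; rewrite setTI.
  + apply: (independent_class (K := int) (emb := fun i => inl (inl i))
      (prj := fun x => if x is inl (inl u) then Some u else None)
      (G := fun i => sigma_generated [set i] (eta 0))) => //.
    * by move=> [[u|[e' i]]|[e' n']].
    * exact: heta0.1.
    * by move=> [[u|[e' i]]|[e' n']].
    * move=> i; apply: sub_sigma_algebra; exists i => //.
      by exists (A (inl (inl i))) => //; rewrite setTI.
Qed.

End sources.

(** * Rotations preserve the uniform law *)

Lemma measurable_circle_repr (R : realType) :
  measurable_fun [set: R] (@circle_repr R).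
Proof.
apply: measurable_funB => //; apply: measurable_funM => //.
have mceil : measurable_fun [set: R] (fun x : R => (Num.ceil x)%:~R : R).
  by apply: nondecreasing_measurable => // x y xy; rewrite ler_int le_ceil.
by apply: (measurableT_comp mceil); apply: measurable_funM => //; exact: measurable_funB.
Qed.

Section rotation.
Context (R : realType) (d : measure_display) (T : measurableType d)
  (P : probability T R) (U : {RV P >-> R}).
Hypothesis U1 : forall w, -1 < U w <= 1.
Hypothesis unifU : forall A, measurable A ->
  distribution P U A = uniform_prob (gtrN (@ltr01 R)) A.

Lemma measurable_RV (A : set R) : measurable A -> measurable [set w | A (U w)].
Proof. by move=> mA; rewrite -[X in measurable X]setTI; exact: measurable_funPT. Qed.

Lemma measurable_gtr x : measurable [set w | x < U w].
Proof.
rewrite (_ : [set w | _] = [set w | `]x, +oo[%classic (U w)]); first exact: measurable_RV.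
by apply/seteqP; split => w /=; rewrite in_itv /= andbT.
Qed.

Lemma uniform_tail x : -1 <= x <= 1 -> Pr P [set w | x < U w] = (1 - x) / 2.
Proof.
move=> /andP[x0 x1].
have := unifU (measurable_itv `]x, +oo[); rewrite /distribution /pushforward.
rewrite (_ : _ @^-1` _ = [set w | x < U w]); last first.
  by apply/seteqP; split => w /=; rewrite in_itv /= andbT.
rewrite /Pr => ->; rewrite /uniform_prob integral_uniform_pdf.
rewrite (_ : _ `&` _ = `]x, 1]%classic); last first.
  apply/seteqP; split => y /=; rewrite !in_itv /= andbT.
    by move=> [-> /andP[_ ->]].
  by move=> /andP[h1 ->]; split => //; rewrite andbT; apply/ltW/(le_lt_trans x0).
rewrite (eq_integral (cst (2^-1)%:E)); last first.
  move=> y; rewrite inE /= in_itv /= => /andP[y0 y1].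
  rewrite /uniform_pdf ifT; first by congr (_%:E); congr (_^-1); lra.
  by rewrite y1 andbT; apply/ltW/(le_lt_trans x0).
rewrite integral_cst//=. 
rewrite lebesgue_measure_itv /= lte_fin.
case: ltP => [_|]; first by rewrite -EFinB -EFinM /= mulrC.
by rewrite mule0 /=; lra.
Qed.

(** Half-lines generate the Borel sets, so it suffices to compare tails. The sum [U w + c] leaves
    the interval exactly when [U w] exceeds [1 - c], and then wraps once. *)
Lemma uniform_rotate c (A : set R) : 0 <= c < 2 -> measurable A ->
  Pr P [set w | A (circle_repr (U w + c))] = Pr P [set w | A (U w)].
Proof.
move=> /andP[c0 c2] mA.
have mV : measurable_fun setT (fun w => circle_repr (U w + c)).
  apply: (measurableT_comp (@measurable_circle_repr R)).
  by apply: measurable_funD => //; exact: measurable_funPT.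
pose V : {mfun T >-> R} := mfun_Sub (mem_set mV).
suff : distribution P V A = distribution P U A.
  by rewrite /distribution /pushforward /Pr => <-.
apply: (measure_unique (@RGenOInfty.G R) (fun n => `]- n%:R, +oo[%classic)) => //.
- exact: RGenOInfty.measurableE.
- move=> _ _ [x ->] [y ->]; exists (Num.max x y).
  by apply/seteqP; split => z /=; rewrite !in_itv /= !andbT gt_max => /andP.
- by move=> n; exists (- n%:R).
- apply/seteqP; split => x // _; exists (Num.truncn `|x|).+1 => //=.
  rewrite in_itv /= andbT ltrNl.
  by apply: le_lt_trans (truncnS_gt _); rewrite -normrN ler_norm.
- move=> _ [x ->].
  change (P ((fun w => circle_repr (U w + c)) @^-1` `]x, +oo[%classic) =
    P (U @^-1` `]x, +oo[%classic)).
  rewrite (_ : U @^-1` _ = [set w | x < U w]); last first.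
    by apply/seteqP; split => w /=; rewrite in_itv /= andbT.
  rewrite (_ : _ @^-1` _ = [set w | x < circle_repr (U w + c)]); last first.
    by apply/seteqP; split => w /=; rewrite in_itv /= andbT.
  have mVx : measurable [set w | x < circle_repr (U w + c)].
    rewrite (_ : [set w | _] = (fun w => circle_repr (U w + c)) @^-1` `]x, +oo[%classic).
      by rewrite -[X in measurable X]setTI; apply: (@mV measurableT).
    by apply/seteqP; split => w /=; rewrite in_itv /= andbT.
  rewrite !PrE//; last exact: measurable_gtr.
  congr (_%:E).
  have [x0|x0] := ltP x (-1).
    have -> : [set w | x < U w] = setT.
      apply/seteqP; split => w //= _.
      by have /andP[+ _] := U1 w; exact: lt_trans.
    rewrite (_ : [set w | _] = setT)//; apply/seteqP; split => w //= _.
    by have /andP[+ _] := circle_repr_itv (U w + c); exact: lt_trans.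
  have [x1|x1] := leP 1 x.
    have -> : [set w | x < U w] = set0.
      by apply/seteqP; split => w //=; have /andP[_] := U1 w; lra.
    rewrite (_ : [set w | _] = set0)//; apply/seteqP; split => w //=.
    by have /andP[_] := circle_repr_itv (U w + c); lra.
  have VE w : circle_repr (U w + c) = if U w <= 1 - c then U w + c else U w + c - 2.
    have /andP[u0 u1] := U1 w; case: ifPn => [h|]; rewrite -?ltNge => *.
      by apply: circle_repr_id; apply/andP; split; lra.
    by apply: (@circle_repr_eq _ _ _ 1); [apply/andP; split; lra|lra].
  rewrite uniform_tail; last by rewrite x0 ltW.
  (* If [x - c >= -1], the event is that [U] lies in the single interval []x - c, 1 - c]]; otherwise
     it is the union of []-1, 1 - c]] and []x + 2 - c, 1]]. Both have length [1 - x]. *)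
  have [xc|xc] := leP (-1) (x - c).
    rewrite (Pr_split P mVx (measurable_gtr (1 - c))).
    have := Pr_split P (measurable_gtr (x - c)) (measurable_gtr (1 - c)).
    rewrite uniform_tail; last by apply/andP; split; lra.
    rewrite (_ : _ `&` _ = [set w | 1 - c < U w]); last first.
      by apply/seteqP; split => w /= => [[]//|h]; split => //; lra.
    rewrite uniform_tail; last by apply/andP; split; lra.
    rewrite (_ : _ `&` _ = set0); last first.
      apply/seteqP; split => w //= [] /=; rewrite VE; have /andP[u0 u1] := U1 w.
      by case: ifPn; rewrite -?ltNge; lra.
    rewrite Pr0 add0r (_ : [set w | x < circle_repr (U w + c)] `\` _ = 
      [set w | x - c < U w] `\` [set w | 1 - c < U w]); first by lra.
    apply/seteqP; split => w /= []; rewrite VE => + /negP; rewrite -leNgt => + h; rewrite h => ?.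
      by split; [lra|apply/negP; rewrite -leNgt].
    by split; [lra|apply/negP; rewrite -leNgt].
  have xc2 : -1 <= x + 2 - c <= 1 by apply/andP; split; lra.
  have c1 : -1 <= 1 - c <= 1 by apply/andP; split; lra.
  rewrite (Pr_split P mVx (measurable_gtr (1 - c))).
  rewrite (_ : _ `&` _ = [set w | x + 2 - c < U w]); last first.
    apply/seteqP; split => w /=; have /andP[u0 u1] := U1 w.
      by rewrite VE => -[]; case: ifPn; rewrite -?ltNge; lra.
    by move=> h; rewrite VE; split; [|lra]; case: ifPn; rewrite -?ltNge; lra.
  rewrite uniform_tail//.
  have -> : [set w | x < circle_repr (U w + c)] `\` [set w | 1 - c < U w] =
     ~` [set w | 1 - c < U w].
    apply/seteqP; split => w /=; first by case.
    move=> /negP; rewrite -leNgt => h; rewrite VE h; split; last by apply/negP; rewrite -leNgt.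
    by have /andP[u0 u1] := U1 w; lra.
  have := Pr_split P measurableT (measurable_gtr (1 - c)).
  rewrite PrT setTI setTD uniform_tail//; lra.
- move=> k; rewrite -ge0_fin_numE ?measure_ge0//.
  exact: fin_num_measure.
Qed.

End rotation.

(** * The cellular automaton *)

Section automaton.
Context {R : realType} (mu : R).
Implicit Types f : source_index -> R.

(** A cell with two or more events counts as silent, an arbitrary choice that matters only on
    [crowded]. *)
Definition rings f (e : int) (i : nat) : bool := f (inl (inr (e, i))) == 1.

Fixpoint ring_count f (e : int) (i : nat) : nat :=
  if i is j.+1 then
    if rings f e j then (ring_count f e j).+1 else ring_count f e j
  else 0%N.

(** The index [i.+1] reads the count after the event, which is how [compass_jump] labels its
    coins. *)
Definition ring_coin f (e : int) (i : nat) : bool :=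
  f (inr (e, ring_count f e i.+1)) == 1.

(** If both edges at [v] ring in the same cell, only the right one acts on [v]. This default keeps
    the map total; such cells are excluded near the vertex under study by the event [crowded]. *)
Fixpoint automaton f (i : nat) (v : int) : R :=
  if i is j.+1 then
    if rings f v j then
      (compass_update mu (ring_coin f v j) (automaton f j v) (automaton f j (v + 1))).1
    else if rings f (v - 1) j then
      (compass_update mu (ring_coin f (v - 1) j) (automaton f j (v - 1)) (automaton f j v)).2
    else automaton f j v
  else f (inl (inl v)).

Lemma automatonS f i v : automaton f i.+1 v =
  if rings f v i then
    (compass_update mu (ring_coin f v i) (automaton f i v) (automaton f i (v + 1))).1
  else if rings f (v - 1) i then
    (compass_update mu (ring_coin f (v - 1) i) (automaton f i (v - 1)) (automaton f i v)).2
  else automaton f i v.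
Proof. by []. Qed.

Definition shift_source (n : int) (x : source_index) : source_index :=
  match x with
  | inl (inl u) => inl (inl (u + n))
  | inl (inr (e, i)) => inl (inr (e + n, i))
  | inr (e, i) => inr (e + n, i)
  end.

Lemma shift_sourceK n : cancel (shift_source n) (shift_source (- n)).
Proof. by move=> [[u|[e i]]|[e i]] /=; rewrite addrK. Qed.

Lemma ring_count_shift f n e i :
  ring_count (f \o shift_source n) e i = ring_count f (e + n) i.
Proof. by elim: i => //= i ->. Qed.

Lemma automaton_shift f n i v :
  automaton (f \o shift_source n) i v = automaton f i (v + n).
Proof.
elim: i v => // i ih v.
rewrite !automatonS /ring_coin !ring_count_shift /rings /comp /shift_source !ih.
by rewrite (addrAC v n 1) (addrAC v n (-1)).
Qed.

Definition rotate_source (c : R) (A : pred int) (x : source_index) (r : R) : R :=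
  if x is inl (inl u) then if A u then circle_repr (r + c) else r else r.

Definition rotate_sources c (A : pred int) f (x : source_index) : R := rotate_source c A x (f x).

Lemma ring_count_rotate f c (A : pred int) e i :
  ring_count (rotate_sources c A f) e i = ring_count f e i.
Proof. by elim: i => //= i ->. Qed.

(** After [i] cells the value at [v] depends only on initial opinions within distance [i]. If all of
    these are rotated, equivariance of [compass_update] passes the rotation on from cell to cell. *)
Lemma automaton_rotate f c (A : pred int) i (v : int) :
  (forall u : int, v - i%:Z <= u <= v + i%:Z -> A u) ->
  automaton (rotate_sources c A f) i v = circle_repr (automaton f i v + c).
Proof.
elim: i v => [|i ih] v Av; first by rewrite /= /rotate_sources /= Av//; lia.
have rE e : rings (rotate_sources c A f) e i = rings f e i by [].
have cE e : ring_coin (rotate_sources c A f) e i = ring_coin f e i.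
  by rewrite /ring_coin ring_count_rotate.
rewrite !automatonS !rE !cE.
have h0 : automaton (rotate_sources c A f) i v = circle_repr (automaton f i v + c).
  by apply: ih => u uv; apply: Av; lia.
case: ifP => _.
  rewrite h0 ih; last by move=> u uv; apply: Av; lia.
  by rewrite compass_update_shift.
case: ifP => _ //.
rewrite h0 ih; last by move=> u uv; apply: Av; lia.
by rewrite compass_update_shift.
Qed.

Lemma automaton_rotate0 f c (A : pred int) i (v : int) :
  (forall u : int, v - i%:Z <= u <= v + i%:Z -> ~~ A u) ->
  automaton (rotate_sources c A f) i v = automaton f i v.
Proof.
elim: i v => [|i ih] v Av.
  by rewrite /= /rotate_sources /= (negbTE (Av v _))//; lia.
have rE e : rings (rotate_sources c A f) e i = rings f e i by [].
have cE e : ring_coin (rotate_sources c A f) e i = ring_coin f e i.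
  by rewrite /ring_coin ring_count_rotate.
rewrite !automatonS !rE !cE.
by rewrite !ih// => u uv; apply: Av; lia.
Qed.

End automaton.

(** * Measurability of the automaton with respect to the past *)

Section automaton_measurable.
Context (R : realType) (mu : R).

(** All coins belong to the past, since a coin is indexed by an event count and not by a time. This
    is harmless: the future events to be separated from the past involve only clock increments over
    cells from [k] on. *)
Definition past (k : nat) : set source_index :=
  [set x | match x with inl (inr (e, i)) => (i < k)%N | _ => True end].

Context (k : nat).
Local Notation space := (g_sigma_algebraType (@cylinders _ R (past k))).

Lemma measurable_compass_update (d : measure_display) (T : measurableType d)
    (b : T -> bool) (x y : T -> R) :
  measurable_fun setT b -> measurable_fun setT x -> measurable_fun setT y ->
  measurable_fun setT (fun w => (compass_update mu (b w) (x w) (y w)).1) /\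
  measurable_fun setT (fun w => (compass_update mu (b w) (x w) (y w)).2).
Proof.
move=> mb mx my.
have mr : measurable_fun setT (fun w => circle_repr (y w - x w)).
  by apply: (measurableT_comp (@measurable_circle_repr R)); exact: measurable_funB.
have md : measurable_fun setT (fun w => compass_direction (b w) (x w) (y w)).
  apply: measurable_fun_ifT => //; first exact: measurable_fun_eqr.
  rewrite (_ : (fun _ => _) = (fun w => if b w then -1 else 1 : R)).
    exact: measurable_fun_ifT.
  by apply/funext => w; case: (b w).
split; apply: (measurableT_comp (@measurable_circle_repr R)).
  by apply: measurable_funD => //; exact: measurable_funM.
by apply: measurable_funB => //; exact: measurable_funM.
Qed.

(** Needed because the index of the coin in use is itself random. *)
Lemma measurable_select (d d' : measure_display) (T : measurableType d)
    (T' : measurableType d') (n : T -> nat) (g : nat -> T -> T') :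
  measurable_fun setT n -> (forall j, measurable_fun setT (g j)) ->
  measurable_fun setT (fun w => g (n w) w).
Proof.
move=> mn mg _ A mA; rewrite setTI.
rewrite (_ : _ @^-1` A = \bigcup_j (n @^-1` [set j] `&` g j @^-1` A)).
  apply: bigcupT_measurable => j; apply: measurableI.
    by rewrite -[X in measurable X]setTI; exact: mn.
  by rewrite -[X in measurable X]setTI; exact: mg.
apply/seteqP; split => w /=; first by move=> ?; exists (n w).
by move=> [j _ /= [->]].
Qed.

Lemma measurable_rings e i : (i < k)%N ->
  measurable_fun [set: space] (fun f : space => rings f e i).
Proof.
move=> ik; apply: measurable_fun_eqr => //.
exact: (@measurable_coordinate _ R (past k) (inl (inr (e, i)))).
Qed.

Lemma measurable_ring_count e i : (i <= k)%N ->
  measurable_fun [set: space] (fun f : space => ring_count f e i).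
Proof.
elim: i => [//|i ih ik]; apply: measurable_fun_ifT.
- exact: measurable_rings.
- by apply: (@measurableT_comp _ _ _ _ _ _ S); [by []|exact: ih (ltnW ik)].
- exact: ih (ltnW ik).
Qed.

Lemma measurable_automaton i v : (i <= k)%N ->
  measurable_fun [set: space] (fun f : space => automaton mu f i v).
Proof.
elim: i v => [v _|i ih v ik].
  exact: (@measurable_coordinate _ R (past k) (inl (inl v))).
have mcoin e : measurable_fun [set: space] (fun f : space => ring_coin f e i).
  apply: measurable_fun_eqr => //.
  apply: (@measurable_select _ _ _ _ (fun f : space => ring_count f e i.+1)
    (fun n (f : space) => f (inr (e, n)))).
    exact: measurable_ring_count.
  by move=> n; exact: (@measurable_coordinate _ R (past k) (inr (e, n))).
apply: measurable_fun_ifT; first exact: measurable_rings.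
  by apply: (measurable_compass_update _ _ _).1 => //; apply: ih; exact: ltnW.
apply: measurable_fun_ifT; first exact: measurable_rings.
  by apply: (measurable_compass_update _ _ _).2 => //; apply: ih; exact: ltnW.
by apply: ih; exact: ltnW.
Qed.

End automaton_measurable.

(** * Paths of the compass model *)

(** The jump time is the first time in [[a, b]] at which the counter has its final value. A rise of
    exactly one leaves only the values [n a] and [n b], so the counter is constant before it. *)
Lemma exists_jump_time (R : realType) (n : R -> nat) (a b : R) :
  0 <= a -> a < b ->
  (forall s t : R, 0 <= s -> s <= t -> (n s <= n t)%N) ->
  (forall t : R, 0 <= t -> \forall s \near t^'+, n s = n t) ->
  n b = (n a).+1 ->
  exists2 t, a < t <= b & [/\ jump_at n t, n t = n b & forall s, a <= s -> s < t -> n s = n a].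
Proof.
move=> a0 ab mono rc nb.
pose S := [set s | a <= s <= b /\ n s = n b].
have Sb : S b by split => //; rewrite lexx ltW.
have hS : has_inf S by split; [exists b|exists a => s [/andP[]]].
have at_ : a <= inf S by apply: lb_le_inf; [exists b|move=> s [/andP[]]].
have tb : inf S <= b by apply: inf_lbound => //; exact: hS.2.
(* Right-continuity makes the infimum attained: [S] has points arbitrarily close above it. *)
have nt : n (inf S) = n b.
  have [e /= e0 He] := rc _ (le_trans a0 at_).
  have [s Ss se] := @inf_adherent R S e e0 hS.
  have := inf_lbound hS.2 Ss; rewrite le_eqVlt => /orP[/eqP ->|ts]; first exact: Ss.2.
  rewrite -(He s)//; first exact: Ss.2.
  by rewrite /ball /= ltr_norml; apply/andP; split; lra.
have at' : a < inf S.
  by rewrite lt_neqAle at_ andbT; apply/eqP => E; move: nb; rewrite -nt -E; lia.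
have ns s : a <= s -> s < inf S -> n s = n a.
  move=> as_ st; have := mono a s a0 as_; have := mono s (inf S) (le_trans a0 as_) (ltW st).
  rewrite nt nb leq_eqVlt => /orP[/eqP nsE|]; last by lia.
  have Ss : S s by split; [rewrite as_ (le_trans (ltW st))|rewrite nb].
  by have := inf_lbound hS.2 Ss; rewrite leNgt st.
exists (inf S); first by rewrite at' tb.
split => //; split; first exact: le_lt_trans a0 at'.
move=> s s0 st; rewrite nt nb ltnS; have [as_|sa] := leP a s; first by rewrite ns.
by apply: mono => //; exact: ltW.
Qed.

Section paths.
Context (R : realType) (d : measure_display) (T : measurableType d)
  (P : probability T R) (mu : R)
  (N : int -> R -> {RV P >-> nat}) (coin : int -> nat -> {RV P >-> bool})
  (eta : R -> int -> {RV P >-> R}).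
Hypothesis heta : compass_model mu N coin eta.

Record good_path (w : T) : Prop := GoodPath {
  good_start : forall e, N e 0 w = 0%N;
  good_mono : forall e (s t : R), 0 <= s -> s <= t -> (N e s w <= N e t w)%N;
  good_right : forall e (t : R), 0 <= t -> \forall s \near t^'+, N e s w = N e t w;
  good_constant : forall (v : int) (s t : R), 0 <= s -> s <= t ->
    N (v - 1) s w = N (v - 1) t w -> N v s w = N v t w -> eta t v w = eta s v w;
  good_jump : forall (u : int) (t x y : R), jump_at (fun s => N u s w) t ->
    circle_cvg t^'- (fun s => eta s u w) x ->
    circle_cvg t^'- (fun s => eta s (u + 1) w) y ->
    (eta t u w, eta t (u + 1) w) = compass_update mu (coin u (N u t w) w) x y
}.

Lemma ae_good_path : \forall w \ae P, good_path w.
Proof.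
have hp e := poisson_path (compass_clock heta e).
(* The integers are enumerated by two copies of [nat], so countably many null sets are discarded. *)
have h1 := ae_foralln (fun n => hp (Posz n)).
have h2 := ae_foralln (fun n => hp (Negz n)).
have h3 := compass_constant heta.
have h4 := compass_jump heta.
apply: filterS2 (filterI h1 h2) (filterI h3 h4) => w [k1 k2] [k3 k4].
split => //.
- by case=> n; [have [] := k1 n|have [] := k2 n].
- by case=> n; [have [] := k1 n|have [] := k2 n].
- by case=> n; [have [] := k1 n|have [] := k2 n].
Qed.

Lemma eta_itv t v w : 0 <= t -> -1 < eta t v w <= 1.
Proof. by move=> t0; have := compass_state heta v w t0; rewrite in_itv. Qed.

Lemma circle_cvg_left_cst (f : R -> R) (a t : R) : a < t ->
  (forall s, a <= s -> s < t -> f s = f a) -> -1 < f a <= 1 ->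
  circle_cvg t^'- f (f a).
Proof.
move=> at_ fE fa; split; first by rewrite in_itv.
apply: (@cvg_trans _ (cst (0 : R) @ t^'-)); last exact: cvg_cst.
apply: near_eq_cvg; near=> s; rewrite fE.
- by rewrite /circle_dist subrr normr0 subr0 minEle ifT.
- by apply/ltW; near: s; exact: nbhs_left_gt.
- by near: s; exact: nbhs_left_lt.
Unshelve. all: by end_near.
Qed.

(** Silence of the two adjacent edges freezes both opinions except at the jump: their left limits
    are the values at [a], and the values after the jump last until [b]. *)
Lemma one_event (w : T) (u : int) (a b : R) : good_path w -> 0 <= a -> a < b ->
  N u b w = (N u a w).+1 -> N (u - 1) a w = N (u - 1) b w ->
  N (u + 1) a w = N (u + 1) b w ->
  (eta b u w, eta b (u + 1) w) =
  compass_update mu (coin u (N u b w) w) (eta a u w) (eta a (u + 1) w).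
Proof.
move=> gw a0 ab nb nl nr.
have [t /andP[at_ tb] [jt ntb ns]] :=
  exists_jump_time a0 ab (good_mono gw u) (good_right gw u) nb.
have t0 := lt_le_trans at_ tb.
have sandwich e s : a <= s -> s <= b -> N e a w = N e b w ->
    N e s w = N e a w /\ N e s w = N e b w.
  move=> as_ sb; have := good_mono gw e a0 as_.
  by have := good_mono gw e (le_trans a0 as_) sb; lia.
have before s : a <= s -> s < t -> eta s u w = eta a u w.
  move=> as_ st; have sb := le_trans (ltW st) tb.
  apply: (good_constant gw) => //; last by rewrite ns.
  by have [->] := sandwich _ _ as_ sb nl.
have before1 s : a <= s -> s < t -> eta s (u + 1) w = eta a (u + 1) w.
  move=> as_ st; have sb := le_trans (ltW st) tb.
  apply: (good_constant gw) => //; first by rewrite addrK ns.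
  by have [->] := sandwich _ _ as_ sb nr.
have := good_jump gw jt (circle_cvg_left_cst at_ before (eta_itv _ _ a0))
  (circle_cvg_left_cst at_ before1 (eta_itv _ _ a0)).
rewrite ntb => <-; congr pair; apply: (good_constant gw) => //;
  rewrite ?addrK ?ntb//; try exact: ltW (le_lt_trans a0 at_).
by have [_ ->] := sandwich _ _ (ltW at_) tb nl.
by have [_ ->] := sandwich _ _ (ltW at_) tb nr.
Qed.

End paths.

(** * Comparison with the automaton *)

Section grid.
Context (R : realType) (d : measure_display) (T : measurableType d)
  (P : probability T R) (mu : R)
  (N : int -> R -> {RV P >-> nat}) (coin : int -> nat -> {RV P >-> bool})
  (eta : R -> int -> {RV P >-> R}).
Context (t : nat -> R) (I : nat) (l r : int) (w : T).
Hypothesis heta : compass_model mu N coin eta.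
Hypothesis gw : good_path mu N coin eta w.
Hypothesis t0 : t 0%N = 0.
Hypothesis tS : forall i, t i < t i.+1.
Hypothesis Nl : N l (t I) w = 0%N.
Hypothesis Nr : N r (t I) w = 0%N.

Local Notation incr e i := (N e (t i.+1) w - N e (t i) w)%N.

Hypothesis le1 : forall i (e : int), (i < I)%N -> l <= e <= r -> (incr e i <= 1)%N.
Hypothesis one : forall i (e e' : int), (i < I)%N -> l <= e <= r -> l <= e' <= r ->
  e != e' -> incr e i = 0%N \/ incr e' i = 0%N.

Let tm : {homo t : m n / (m <= n)%N >-> m <= n}.
Proof. by apply: homo_leq => // [x y z|i]; [exact: le_trans|exact: ltW]. Qed.

Let tge0 i : 0 <= t i. Proof. by rewrite -t0; exact: tm. Qed.

Let Nm e i : (N e (t i) w <= N e (t i.+1) w)%N.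
Proof. by apply: (good_mono gw) => //; exact: ltW. Qed.

Let f := fun x => source N coin eta t x w.

Let ringsE e i : rings f e i = (incr e i == 1)%N.
Proof. by rewrite /rings /f /= (eqr_nat _ _ 1). Qed.

Lemma ring_count_grid (e : int) i : (i <= I)%N -> l <= e <= r ->
  ring_count f e i = N e (t i) w.
Proof.
move=> + er; elim: i => [_|i ih iI]; first by rewrite t0 (good_start gw).
rewrite [LHS]/= ringsE ih ?(ltnW iI)//; have := le1 iI er; have := Nm e i.
by case: eqP; lia.
Qed.

(** The edge [l] joins [l] to [l + 1] and [r] joins [r] to [r + 1], so the two silent edges enclose
    exactly the vertices of []l, r]]. An edge strictly between them joins two such vertices, and the
    induction over cells never leaves this set. *)
Lemma grid_automaton i (x : int) : (i <= I)%N -> l < x <= r ->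
  eta (t i) x w = automaton mu f i x.
Proof.
elim: i x => [|i ih] x iI xr; first by rewrite t0.
have still (e : int) : e = l \/ e = r -> incr e i = 0%N.
  have Ni : (N e (t i.+1) w <= N e (t I) w)%N by apply: (good_mono gw) => //; exact: tm.
  by case=> E; move: Ni; rewrite E ?Nl ?Nr; lia.
have flat e : incr e i = 0%N -> N e (t i) w = N e (t i.+1) w.
  by have := Nm e i; lia.
have rise e : incr e i = 1%N -> N e (t i.+1) w = (N e (t i) w).+1.
  by have := Nm e i; lia.
have event (u : int) : l < u < r -> incr u i = 1%N ->
    (eta (t i.+1) u w, eta (t i.+1) (u + 1) w) =
    compass_update mu (ring_coin f u i) (automaton mu f i u) (automaton mu f i (u + 1)).
  move=> ur u1; have ul : l <= u <= r by lia.
  have quiet (e : int) : l <= e <= r -> e != u -> N e (t i) w = N e (t i.+1) w.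
    by move=> er eu; apply: flat; have [//|] := one iI er ul eu; rewrite u1.
  rewrite (one_event heta gw (tge0 i) (tS i) (rise _ u1)); last 2 first.
  - by apply: quiet; [lia|apply/eqP; lia].
  - by apply: quiet; [lia|apply/eqP; lia].
  rewrite !ih ?(ltnW iI)//; [|lia|lia].
  congr (compass_update _ _ _ _).
  rewrite /ring_coin ring_count_grid// /f /=.
  by case: (coin u _ w); rewrite ?eqxx // eq_sym oner_eq0.
rewrite automatonS !ringsE.
have [x1|x1] := eqVneq (incr x i) 1%N.
  have xlr : l < x < r.
    have [xE|] := eqVneq x r; last by lia.
    by move: x1; rewrite (still x (or_intror xE)).
  by rewrite -(event x xlr x1).
have [y1|y1] := eqVneq (incr (x - 1) i) 1%N.
  have xlr : l < x - 1 < r.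
    have [xE|] := eqVneq (x - 1) l; last by lia.
    by move: y1; rewrite (still (x - 1) (or_introl xE)).
  by have := event (x - 1) xlr y1; rewrite subrK => <-.
rewrite -ih ?(ltnW iI)//.
apply: (good_constant gw) => //; first exact: ltW.
  by apply: flat; have := le1 iI (_ : l <= x - 1 <= r); lia.
by apply: flat; have := le1 iI (_ : l <= x <= r); lia.
Qed.

End grid.

Definition mesh (R : realType) (m i : nat) : R := i%:R / m.+1%:R.

Lemma sum_le_size (R : realType) (I : Type) (s : seq I) (F : I -> R) (c : R) :
  (forall i, F i <= c) -> \sum_(i <- s) F i <= (size s)%:R * c.
Proof.
move=> Fc; elim: s => [|i s ih]; first by rewrite big_nil mul0r.
by rewrite big_cons /= -addn1 natrD mulrDl mul1r addrC lerD.
Qed.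

Section approximation.
Context (R : realType) (d : measure_display) (T : measurableType d)
  (P : probability T R) (mu : R)
  (N : int -> R -> {RV P >-> nat}) (coin : int -> nat -> {RV P >-> bool})
  (eta : R -> int -> {RV P >-> R}).
Hypothesis heta : compass_model mu N coin eta.
Hypothesis heta0 : iid_uniform (eta 0).

Local Notation incr e s t w := (N e t w - N e s w)%N.

Lemma measurable_incr (e : int) (s t : R) (Q : nat -> Prop) :
  measurable [set w | Q (incr e s t w)].
Proof.
have := @measurable_fun_nat2 R _ T (N e t) (N e s) (fun a b => `[< Q (a - b)%N >]%:R)
  (measurable_funPT _) (measurable_funPT _) measurableT _ (measurable_set1 1).
rewrite setTI (_ : _ @^-1` _ = [set w | Q (incr e s t w)])//.
apply/seteqP; split => w /=; case: asboolP => // _ /eqP.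
by rewrite eq_sym oner_eq0.
Qed.

Lemma measurable_incr_ge (e : int) (s t : R) k :
  measurable [set w | (k <= incr e s t w)%N].
Proof. exact: (@measurable_incr e s t (fun j => (k <= j)%N)). Qed.

Lemma Pr_incr (e : int) (s t : R) k : 0 <= s -> s < t ->
  Pr P [set w | incr e s t w = k] =
  (t - s) ^+ k * k`!%:R^-1 * expR (- (t - s)).
Proof.
move=> s0 st; rewrite /Pr (poisson_increment (compass_clock heta e) k s0 st).
by rewrite mul1r /poisson_pmf subr_gt0 st.
Qed.

Lemma Pr_incr_gt0 (e : int) (s t : R) : 0 <= s -> s < t ->
  Pr P [set w | (1 <= incr e s t w)%N] = 1 - expR (- (t - s)).
Proof.
move=> s0 st; have := Pr_incr e 0 s0 st; rewrite expr0 fact0 invr1 !mul1r => <-.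
have := Pr_split P measurableT (@measurable_incr e s t (fun k => k = 0%N)).
rewrite PrT setTI => ->; rewrite addrC addKr; congr Pr.
by apply/seteqP; split => w /=; [move=> ?; split => //; lia|move=> [_]; lia].
Qed.

Lemma Pr_incr_gt0_le (e : int) (s t : R) : 0 <= s -> s < t ->
  Pr P [set w | (1 <= incr e s t w)%N] <= t - s.
Proof.
by move=> s0 st; rewrite Pr_incr_gt0//; have := expR_ge1Dx (- (t - s)); lra.
Qed.

Lemma Pr_incr_gt1_le (e : int) (s t : R) : 0 <= s -> s < t ->
  Pr P [set w | (2 <= incr e s t w)%N] <= (t - s) ^+ 2.
Proof.
move=> s0 st.
have := Pr_split P (@measurable_incr_ge e s t 1)
  (@measurable_incr_ge e s t 2).
rewrite (_ : _ `&` _ = [set w | (2 <= incr e s t w)%N]); last first.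
  by apply/seteqP; split => w /=; [case|move=> ?; split => //; lia].
rewrite (_ : _ `\` _ = [set w | incr e s t w = 1%N]); last first.
  by apply/seteqP; split => w /=; [case=> ? ?; lia|move=> ->].
rewrite Pr_incr_gt0// (Pr_incr _ _ s0 st) expr1 factS fact0 invr1 mulr1.
(* Since e^(-h) >= 1 - h, the remainder 1 - (1 + h) e^(-h) is at most 1 - (1 + h)(1 - h) = h^2. *)
have := expR_ge1Dx (- (t - s)); set h := t - s; have h0 : 0 < h by rewrite subr_gt0.
by have := expR_gt0 (- h); nra.
Qed.

Lemma Pr_incr_pair_le (e e' : int) (s t : R) : 0 <= s -> s < t -> e != e' ->
  Pr P ([set w | (1 <= incr e s t w)%N] `&` [set w | (1 <= incr e' s t w)%N])
  <= (t - s) ^+ 2.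
Proof.
move=> s0 st ee.
(* A mesh whose cell 0 is [[s, t]], so that [source_independent] applies. *)
pose u i := s + i%:R * (t - s).
have um : {homo u : m n / (m <= n)%N >-> m <= n}.
  by move=> m n mn; rewrite /u lerD2l ler_wpM2r ?ler_nat// subr_ge0 ltW.
have u0 : 0 <= u 0%N by rewrite /u mul0r addr0.
have uE : u 0%N = s /\ u 1%N = t by rewrite /u; split; lra.
have := (source_independent heta heta0 u0 um).2
  [:: inl (inr (e, 0%N)); inl (inr (e', 0%N))] (fun=> [set x | 1 <= x]).
rewrite big_cons big_seq1 /= andbT inE.
have -> : (inl (inr (e, 0%N)) == inl (inr (e', 0%N)) :> source_index) = false.
  by apply/negbTE/eqP => -[] /eqP; exact/negP.
have mge : measurable [set x : R | 1 <= x].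
  rewrite (_ : [set x : R | 1 <= x] = `[1, +oo[%classic) //.
  by apply/seteqP; split => x /=; rewrite in_itv /= andbT.
move=> /(_ isT (fun=> mge)).
have hE (a : int) : source N coin eta u (inl (inr (a, 0%N))) @^-1` [set x | 1 <= x] =
    [set w | (1 <= incr a s t w)%N].
  by apply/seteqP; split => w /=; rewrite uE.1 uE.2 (ler_nat _ 1).
rewrite !hE (_ : [set w | forall i, _] = [set w | (1 <= incr e s t w)%N] `&`
    [set w | (1 <= incr e' s t w)%N]).
  move=> ->; rewrite expr2; apply: ler_pM; rewrite ?Pr_ge0//; exact: Pr_incr_gt0_le.
apply/seteqP; split => w /=.
  move=> H; split.
    by have := H (inl (inr (e, 0%N))); rewrite inE eqxx /= uE.1 uE.2 (ler_nat _ 1); apply.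
  by have := H (inl (inr (e', 0%N))); rewrite !inE eqxx orbT /= uE.1 uE.2 (ler_nat _ 1); apply.
by move=> [h1 h2] i; rewrite !inE => /orP[]/eqP -> /=; rewrite uE.1 uE.2 (ler_nat _ 1).
Qed.

(** A long row of edges is unlikely to ring entirely; this geometric value is what yields a silent
    edge on each side of a vertex. *)
Lemma Pr_all_ring (H : R) (s : seq int) : 0 < H -> uniq s ->
  measurable [set w | forall e, e \in s -> (1 <= N e H w - N e 0 w)%N] /\
  Pr P [set w | forall e, e \in s -> (1 <= N e H w - N e 0 w)%N] =
  (1 - expR (- H)) ^+ size s.
Proof.
move=> H0 us; split.
  rewrite (_ : [set w | _] = \bigcap_(e in [set` s]) [set w | (1 <= incr e 0 H w)%N]).
    by rewrite bigcap_seq; apply: bigsetI_measurable => e _; exact: measurable_incr_ge.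
  by apply/seteqP; split.
pose u i := i%:R * H.
have um : {homo u : m n / (m <= n)%N >-> m <= n}.
  by move=> m n mn; rewrite /u ler_wpM2r ?ler_nat// ltW.
have u0 : 0 <= u 0%N by rewrite /u mul0r.
have uE : u 0%N = 0 /\ u 1%N = H by rewrite /u mul0r mul1r.
have := (source_independent heta heta0 u0 um).2
  [seq inl (inr (e, 0%N)) | e <- s] (fun=> [set x | 1 <= x]).
have mge : measurable [set x : R | 1 <= x].
  rewrite (_ : [set x : R | 1 <= x] = `[1, +oo[%classic) //.
  by apply/seteqP; split => x /=; rewrite in_itv /= andbT.
rewrite map_inj_uniq; last by move=> x y [].
move=> /(_ us (fun=> mge)); rewrite big_map.
rewrite (eq_bigr (fun=> 1 - expR (- H))); last first.
  move=> e _; rewrite -[in RHS](subr0 H) -(@Pr_incr_gt0 e 0 H)//; congr Pr.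
  by apply/seteqP; split => w /=; rewrite uE.1 uE.2 (ler_nat _ 1).
rewrite big_const_seq count_predT iter_mulr_1 => <-; congr Pr.
apply/seteqP; split => w /= h e.
  by move=> /mapP[x xs ->] /=; rewrite uE.1 uE.2 (ler_nat _ 1) h.
by move=> es; have := h (inl (inr (e, 0%N))) (map_f _ es); rewrite /= uE.1 uE.2 (ler_nat _ 1).
Qed.

(** * Cells with more than one event near a vertex *)

Section bad_set.
Context (m K I : nat) (v : int).

Local Notation t := (mesh R m).
Local Notation cell e i w := (incr e (t i) (t i.+1) w).

Definition window : seq int := [seq v - K%:Z + j%:Z | j <- iota 0 (2 * K)].

Definition crowded : set T :=
  \big[setU/set0]_(i <- iota 0 I) \big[setU/set0]_(e <- window)
    ([set w | (2 <= cell e i w)%N] `|`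
     \big[setU/set0]_(e' <- window) if e == e' then set0 else
       [set w | (1 <= cell e i w)%N] `&` [set w | (1 <= cell e' i w)%N]).

Lemma mesh_ge0 i : 0 <= t i. Proof. by rewrite /mesh divr_ge0. Qed.

Lemma meshS i : t i < t i.+1.
Proof. by rewrite /mesh ltr_pM2r ?invr_gt0// ltr_nat. Qed.

Lemma mesh_step i : t i.+1 - t i = m.+1%:R^-1.
Proof. by rewrite /mesh -mulrBl -natrB// subSnn mul1r. Qed.

Lemma measurable_pair e e' i : measurable (if e == e' then set0 else
       [set w | (1 <= cell e i w)%N] `&` [set w | (1 <= cell e' i w)%N]).
Proof. by case: ifP => // _; apply: measurableI; exact: measurable_incr_ge. Qed.

Lemma measurable_crowded : measurable crowded.
Proof.
apply: bigsetU_measurable => i _; apply: bigsetU_measurable => e _.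
apply: measurableU; first exact: measurable_incr_ge.
by apply: bigsetU_measurable => e' _; exact: measurable_pair.
Qed.

(** A cell of length h is crowded with probability of order h^2, and a bounded time interval has of
    order 1/h cells, so the total will vanish with the mesh. *)
Lemma Pr_crowded_le :
  Pr P crowded <= I%:R * ((2 * K)%:R * (m.+1%:R^-1 ^+ 2 + (2 * K)%:R * m.+1%:R^-1 ^+ 2)).
Proof.
have mE e i : measurable ([set w | (2 <= cell e i w)%N] `|`
     \big[setU/set0]_(e' <- window) if e == e' then set0 else
       [set w | (1 <= cell e i w)%N] `&` [set w | (1 <= cell e' i w)%N]).
  apply: measurableU; first exact: measurable_incr_ge.
  by apply: bigsetU_measurable => e' _; exact: measurable_pair.
apply: le_trans (Pr_bigU_le _ _ _) _.
  by move=> i; apply: bigsetU_measurable.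
rewrite -{2}(size_iota 0 I); apply: sum_le_size => i.
apply: le_trans (Pr_bigU_le _ _ _) _ => //.
have sw : size window = (2 * K)%N by rewrite size_map size_iota.
rewrite -{1}sw; apply: sum_le_size => e.
apply: le_trans (PrU_le _ _ _) _.
- exact: measurable_incr_ge.
- by apply: bigsetU_measurable => e' _; exact: measurable_pair.
apply: lerD.
  by rewrite -(mesh_step i); apply: Pr_incr_gt1_le; [exact: mesh_ge0|exact: meshS].
apply: le_trans (Pr_bigU_le _ _ _) _; first by move=> e'; exact: measurable_pair.
rewrite -sw; apply: sum_le_size => e'; case: ifPn => [_|ee].
  by rewrite Pr0 exprn_ge0// invr_ge0.
by rewrite -(mesh_step i); apply: Pr_incr_pair_le => //; [exact: mesh_ge0|exact: meshS].
Qed.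

Lemma mem_window (e : int) : v - K%:Z <= e < v + K%:Z -> e \in window.
Proof.
move=> eK; apply/mapP; exists (absz (e - (v - K%:Z))%R); last by lia.
by rewrite mem_iota; lia.
Qed.

Lemma uncrowdedP w : ~ crowded w ->
  forall i, (i < I)%N -> forall e : int, v - K%:Z <= e < v + K%:Z ->
    (cell e i w <= 1)%N /\
    forall e' : int, v - K%:Z <= e' < v + K%:Z -> e != e' ->
      cell e i w = 0%N \/ cell e' i w = 0%N.
Proof.
move=> ncr i iI e eK.
have ncri : ~ ([set w | (2 <= cell e i w)%N] `|`
     \big[setU/set0]_(e' <- window) if e == e' then set0 else
       [set w | (1 <= cell e i w)%N] `&` [set w | (1 <= cell e' i w)%N]) w.
  move=> H; apply: ncr; rewrite /crowded -bigcup_seq; exists i => /=.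
    by rewrite mem_iota.
  by rewrite -bigcup_seq; exists e => //=; exact: mem_window.
split.
  by rewrite leqNgt; apply/negP => h; apply: ncri; left.
move=> e' eK' ee; case E : (cell e i w) => [|a]; [by left|right].
case E' : (cell e' i w) => [//|b]; exfalso; apply: ncri; right.
rewrite -bigcup_seq; exists e'; first exact: mem_window.
by rewrite (negbTE ee); split => /=; rewrite ?E ?E'.
Qed.

End bad_set.

(** The mesh is chosen before the vertex: shift invariance compares two vertices on one mesh, and
    [rarely_close] picks its distance as a function of [m]. *)
Lemma automaton_approx (L : nat) (del : R) : 0 < del ->
  exists m, forall v, exists2 B : set T, measurable B /\ Pr P B <= del &
    forall w, ~ B w -> forall k, (k <= L)%N ->
      eta k%:R v w = automaton mu (fun x => source N coin eta (mesh R m) x w) (k * m.+1) v.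
Proof.
(* The horizon [L.+1] is positive even if [L] is 0. *)
move=> del0; pose H : R := L.+1%:R; have H0 : 0 < H by rewrite ltr0n.
pose q := 1 - expR (- H).
have q0 : 0 <= q < 1.
  have : expR (- H) <= 1 by rewrite -(expR0 R) ler_expR oppr_le0 ltW.
  by have := expR_gt0 (- H); rewrite /q => ? ?; apply/andP; split; lra.
(* The budget is [del / 4] for a missing silent edge on each side of [v], and [del / 2] for
   crowding. *)
have [K HK] : exists K, q ^+ K <= del / 4.
  have : q ^+ K @[K --> \oo] --> 0 by apply: cvg_expr; rewrite ger0_norm; lra.
  move=> /cvgr_le /(_ (del / 4) _) []; first by lra.
  by move=> K _ /(_ K (leqnn K)) HK; exists K.
(* The bound of [Pr_crowded_le] for [L.+1 * m.+1] cells is [C / m.+1], whatever the vertex. *)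
pose C := L.+1%:R * ((2 * K)%:R * (1 + (2 * K)%:R)) : R.
have C0 : 0 <= C by rewrite /C !mulr_ge0// addr_ge0.
pose m := Num.truncn (2 * C / del).
have Cm : C * m.+1%:R^-1 <= del / 2.
  have := truncnS_gt (2 * C / del); rewrite -/m ltr_pdivrMr// => h.
  by rewrite ler_pdivrMr ?ltr0n//; lra.
exists m => v; pose I := (L.+1 * m.+1)%N.
have tI : mesh R m I = H by rewrite /mesh /I natrM mulfK.
have [B [mB PB] gB] := ae_null (ae_good_path heta).
(* The row [s1] begins with the edge from [v] to [v + 1], and [s2] ends with the edge from [v - 1]
   to [v]. *)
pose s1 := [seq v + j%:Z | j <- iota 0 K]; pose s2 := [seq v - K%:Z + j%:Z | j <- iota 0 K].
have us1 : uniq s1 by rewrite map_inj_uniq ?iota_uniq// => x y; lia.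
have us2 : uniq s2 by rewrite map_inj_uniq ?iota_uniq// => x y; lia.
have [m1 P1] := Pr_all_ring H0 us1; have [m2 P2] := Pr_all_ring H0 us2.
move: m1 m2 P1 P2; set B1 := [set w | _]; set B2 := [set w | _].
rewrite !size_map size_iota -/q => m1 m2 P1 P2.
exists (B `|` (B1 `|` (B2 `|` crowded m K I v))).
  have m3 := measurable_crowded m K I v.
  split; first by do 3 apply: measurableU => //.
  apply: le_trans (PrU_le _ _ _) _ => //; first by do 2 apply: measurableU => //.
  rewrite PB add0r; apply: le_trans (PrU_le _ _ _) _ => //; first exact: measurableU.
  rewrite P1; have h := PrU_le P m2 m3.
  have := Pr_crowded_le m K I v.
  have -> : I%:R * ((2 * K)%:R * (m.+1%:R^-1 ^+ 2 + (2 * K)%:R * m.+1%:R^-1 ^+ 2)) =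
      C * m.+1%:R^-1.
    rewrite /I /C natrM expr2; set a := m.+1%:R; have a0 : a != 0 by rewrite pnatr_eq0.
    by field.
  move=> /le_trans /(_ Cm); move: h; rewrite P2 => h h3.
  set z1 := Pr P _ in h h3 *; set z2 := Pr P _ in h h3 *; set z3 := q ^+ K in h HK *.
  by clearbody z1 z2 z3; lra.
move=> w nB k kL.
have gw : good_path mu N coin eta w by apply: gB => Bw; apply: nB; left.
have := @uncrowdedP m K I v w (fun h => nB (or_intror (or_intror (or_intror h)))).
move=> unc.
have [j jK Nj] : exists2 j, (j < K)%N & N (v + j%:Z) H w = 0%N.
  apply: contrapT => h; apply: nB; right; left => e /mapP[j].
  rewrite mem_iota => jK ->; rewrite (good_start gw) subn0 lt0n.
  by apply/eqP => E; apply: h; exists j.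
have [i iK Ni] : exists2 j, (j < K)%N & N (v - K%:Z + j%:Z) H w = 0%N.
  apply: contrapT => h; apply: nB; right; right; left => e /mapP[j'].
  rewrite mem_iota => jK' ->; rewrite (good_start gw) subn0 lt0n.
  by apply/eqP => E; apply: h; exists j'.
have -> : k%:R = mesh R m (k * m.+1) by rewrite /mesh natrM mulfK.
apply: (@grid_automaton _ _ _ _ _ _ _ _ (mesh R m) I (v - K%:Z + i%:Z) (v + j%:Z)) => //.
- by rewrite /mesh mul0r.
- exact: meshS.
- by rewrite tI.
- by rewrite tI.
- by move=> c e cI ec; apply: (unc c cI e _).1; lia.
- by move=> c e e' cI ec ec'; apply: (unc c cI e _).2; lia.
- by rewrite /I leq_mul2r (leq_trans kL).
- by lia.
Qed.

End approximation.

(** * Invariance and independence *)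

Section laws.
Context (R : realType) (d : measure_display) (T : measurableType d)
  (P : probability T R) (mu : R)
  (N : int -> R -> {RV P >-> nat}) (coin : int -> nat -> {RV P >-> bool})
  (eta : R -> int -> {RV P >-> R}).
Hypothesis heta : compass_model mu N coin eta.
Hypothesis heta0 : iid_uniform (eta 0).

Local Notation src t w := (fun x : source_index => source N coin eta t x w).
Local Notation space J := (g_sigma_algebraType (@cylinders _ R J)).
Local Notation incr e s t w := (N e t w - N e s w)%N.

Lemma mesh_homo m : {homo mesh R m : i j / (i <= j)%N >-> i <= j}.
Proof. by apply: homo_leq => // [x y z|i]; [exact: le_trans|exact/ltW/meshS]. Qed.

Lemma mesh_independent m : jointly_independent P (source N coin eta (mesh R m)).
Proof. by apply: source_independent heta heta0 _ _ _; [exact: mesh_ge0|exact: mesh_homo]. Qed.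

Lemma Pr_incr_eq (e e' : int) (s t : R) (S : set nat) : 0 <= s -> s < t ->
  Pr P [set w | S (incr e s t w)] = Pr P [set w | S (incr e' s t w)].
Proof.
move=> s0 st.
have sumE (a : int) : P [set w | S (incr a s t w)] =
    (\sum_(k <oo | k \in S) ((t - s) ^+ k * k`!%:R^-1 * expR (- (t - s)))%:E)%E.
  rewrite (_ : [set w | _] = \bigcup_(k in S) [set w | incr a s t w = k]).
    rewrite measure_bigcup.
    - apply: eq_eseriesr => k _; rewrite -(Pr_incr heta a k s0 st) -PrE//.
      exact: (measurable_incr N a s t (fun j => j = k)).
    - by move=> k _; exact: (measurable_incr N a s t (fun j => j = k)).
    - by move=> i j _ _ [w [/= <- <-]].
  by apply/seteqP; split => w /=; [move=> h; exists (incr a s t w)|move=> [k Sk /= ->]].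
by rewrite /Pr !sumE.
Qed.

Lemma Pr_coin (e : int) (n : nat) (S : set bool) :
  Pr P [set w | S (coin e n w)] = (`[< S true >]%:R + `[< S false >]%:R) / 2.
Proof.
have mt (b : bool) : measurable [set w | coin e n w = b].
  have := @measurable_funPT _ _ _ _ (coin e n) measurableT [set b] Logic.I.
  by rewrite setTI.
have pt : Pr P [set w | coin e n w = true] = 2^-1.
  by have := compass_coin heta e n; rewrite /Pr => ->.
have pf : Pr P [set w | coin e n w = false] = 2^-1.
  have := Pr_split P measurableT (mt true).
  rewrite PrT setTI pt (_ : _ `\` _ = [set w | coin e n w = false]); first by lra.
  by apply/seteqP; split => w /=; case: (coin e n w) => //; case.
have [St|St] := pselect (S true); have [Sf|Sf] := pselect (S false).
- rewrite (_ : [set w | _] = setT) ?PrT; last by apply/seteqP; split => w //= _; case: (coin e n w).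
  by rewrite !asboolT//=; lra.
- rewrite (_ : [set w | _] = [set w | coin e n w = true]) ?pt; last first.
    by apply/seteqP; split => w /=; case: (coin e n w).
  by rewrite asboolT// asboolF//=; lra.
- rewrite (_ : [set w | _] = [set w | coin e n w = false]) ?pf; last first.
    by apply/seteqP; split => w /=; case: (coin e n w).
  by rewrite asboolF// asboolT//=; lra.
- rewrite (_ : [set w | _] = set0) ?Pr0; last by apply/seteqP; split => w //=; case: (coin e n w).
  by rewrite !asboolF//=; lra.
Qed.

Lemma source_shift_law m (n : int) (D : set (space setT)) : measurable D ->
  Pr P [set w | D (src (mesh R m) w)] =
  Pr P [set w | D (src (mesh R m) w \o shift_source n)].
Proof.
have iX := mesh_independent m.
apply: (eq_law iX (jointly_independent_reindex (shift_sourceK n) iX)).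
move=> [[u|[e i]]|[e i]] A mA /=.
- have := heta0.2 u A mA; have := heta0.2 (u + n) A mA.
  by rewrite /distribution /pushforward /Pr => -> ->.
- exact: (@Pr_incr_eq e (e + n) _ _ (fun k => A k%:R) (mesh_ge0 R m i) (meshS R m i)).
- change (Pr P [set w | [set b : bool | A b%:R] (coin e i w)] =
    Pr P [set w | [set b : bool | A b%:R] (coin (e + n) i w)]).
  by rewrite !Pr_coin.
Qed.

Lemma measurable_rotate_source c (A : pred int) x :
  measurable_fun [set: R] (rotate_source c A x).
Proof.
case: x => [[u|?]|?]; [|exact: measurable_id..].
rewrite /rotate_source; case: (A u); last exact: measurable_id.
by apply: (measurableT_comp (@measurable_circle_repr R)); exact: measurable_funD.
Qed.

Lemma source_rotate_law m c (A : pred int) (D : set (space setT)) :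
  0 <= c < 2 -> measurable D ->
  Pr P [set w | D (rotate_sources c A (src (mesh R m) w))] =
  Pr P [set w | D (src (mesh R m) w)].
Proof.
move=> c02; have iX := mesh_independent m.
apply: (eq_law (jointly_independent_comp (measurable_rotate_source c A) iX) iX).
move=> [[u|[e i]]|[e i]] B mB //.
rewrite /comp /preimage /rotate_source /=; case: (A u) => //.
apply: (@uniform_rotate _ _ _ _ (eta 0 u)) => //.
  by move=> w; apply: (eta_itv heta).
by move=> B' mB'; exact: heta0.2.
Qed.

Definition solo_event (v : int) (a b : R) : set T :=
  [set w | [/\ incr v a b w = 1%N, incr (v - 1) a b w = 0%N & incr (v + 1) a b w = 0%N]].

Lemma measurable_solo_event v a b : measurable (solo_event v a b).
Proof.
rewrite (_ : solo_event v a b = [set w | incr v a b w = 1%N] `&`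
  ([set w | incr (v - 1) a b w = 0%N] `&` [set w | incr (v + 1) a b w = 0%N])).
  have h (e : int) j := measurable_incr N e a b (fun i => i = j).
  by apply: measurableI; [exact: h|apply: measurableI; exact: h].
by apply/seteqP; split => w /=; [case|case=> ? []].
Qed.

(** Each of the three edges contributes one factor e^(-1), because a Poisson variable of mean 1
    takes the values 0 and 1 with this same probability. Independence is checked on cylinders, by
    adding three coordinates to their list. *)
Lemma solo_event_independent m k (v : int) (D : set (space (past (k * m.+1)))) :
  measurable D ->
  Pr P ([set w | D (src (mesh R m) w)] `&` solo_event v k%:R k.+1%:R) =
  expR (-1) ^+ 3 * Pr P [set w | D (src (mesh R m) w)].
Proof.
have iX := mesh_independent m.
apply: (pi_lambda_family (X := source N coin eta (mesh R m))).
- by rewrite exprn_ge0// expR_ge0.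
- exact: iX.1.
- exact: iX.1.
- exact: measurable_solo_event.
move=> _ [s [A [us sJ mA ->]]].
pose I := (k * m.+1)%N.
(* the mesh up to time [k], followed by unit steps *)
pose t i : R := if (i <= I)%N then mesh R m i else (k + (i - I))%:R.
have tI : t I = k%:R by rewrite /t leqnn /mesh natrM mulfK.
have tI1 : t I.+1 = k.+1%:R by rewrite /t ltnn subSnn addn1.
have tm : {homo t : i j / (i <= j)%N >-> i <= j}.
  apply: homo_leq => // [x y z|i]; first exact: le_trans.
  rewrite /t; have [iI|Ii] := ltnP i I.
    by rewrite (ltnW iI); exact/ltW/meshS.
  move: Ii; rewrite leq_eqVlt => /orP[/eqP <-|Ii].
    by rewrite leqnn subSnn /mesh natrM mulfK// ler_nat leq_addr.
  by rewrite leqNgt Ii /= ler_nat; lia.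
have t0 : 0 <= t 0%N by rewrite /t leq0n; exact: mesh_ge0.
have iY := source_independent heta heta0 t0 tm.
have XY x : x \in s -> forall w, source N coin eta t x w = source N coin eta (mesh R m) x w.
  move=> /sJ; case: x => [[u|[e i]]|[e i]] //= iI w.
  by rewrite /t (ltnW iI) iI.
pose x0 : source_index := inl (inr (v, I)).
pose xl : source_index := inl (inr (v - 1, I)).
pose xr : source_index := inl (inr (v + 1, I)).
have ns (e : int) : inl (inr (e, I)) \notin s.
  by apply/negP => /sJ /=; rewrite ltnn.
pose B x := if x \in s then A x else if x == x0 then [set 1] else [set (0 : R)].
have mB x : measurable (B x) by rewrite /B; case: ifP => // _; case: ifP.
have neq (e e' : int) : e != e' -> (inl (inr (e, I)) == inl (inr (e', I)) :> source_index) = false.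
  by move=> ee; apply/negbTE/eqP => -[] /eqP; exact/negP.
have u3 : uniq [:: x0, xl, xr & s].
  rewrite /= us !inE !negb_or !ns !neq//; apply/eqP; lia.
have := iY.2 _ B u3 mB; rewrite !big_cons.
have B0 : B x0 = [set 1] by rewrite /B (negbTE (ns _)) eqxx.
have Bl : B xl = [set 0] by rewrite /B (negbTE (ns _)) neq//; apply/eqP; lia.
have Br : B xr = [set 0] by rewrite /B (negbTE (ns _)) neq//; apply/eqP; lia.
rewrite B0 Bl Br.
have k01 : 0 <= k%:R :> R by [].
have kk1 : k%:R < k.+1%:R :> R by rewrite ltr_nat.
have kk : k.+1%:R - k%:R = 1 :> R by rewrite -natrB// subSnn.
have P1 (e : int) (c : nat) : (c <= 1)%N ->
    Pr P (source N coin eta t (inl (inr (e, I))) @^-1` [set c%:R]) = expR (-1).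
  move=> c1; have := Pr_incr heta e c k01 kk1; rewrite kk expr1n !mul1r.
  rewrite (_ : c`! = 1%N) ?invr1 ?mul1r; last by case: c c1 => [|[|]].
  move=> <-; congr Pr; apply/seteqP; split => w /=; rewrite tI tI1.
    by move/eqP; rewrite eqr_nat => /eqP.
  by move=> ->.
rewrite (P1 v 1%N)// !(P1 _ 0%N)//.
rewrite (_ : \prod_(i <- s) _ = Pr P [set w | forall i, i \in s ->
    A i (source N coin eta (mesh R m) i w)]).
  move=> E; rewrite (_ : _ `&` _ = [set w | forall i, i \in [:: x0, xl, xr & s] ->
      B i (source N coin eta t i w)]).
    by rewrite E; ring.
  apply/seteqP; split => w /=.
    move=> [sA [h0 hl hr]] i; rewrite !inE => /or4P[/eqP ->|/eqP ->|/eqP ->|si].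
    - by rewrite B0 /= tI tI1 h0.
    - by rewrite Bl /= tI tI1 hl.
    - by rewrite Br /= tI tI1 hr.
    - by rewrite /B si XY//; exact: sA.
  move=> h; split.
    by move=> i si; have := h i; rewrite /B !inE si !orbT XY//; apply.
  split.
  - have := h x0; rewrite B0 inE eqxx /= tI tI1 => /(_ isT) /eqP.
    by rewrite (eqr_nat _ _ 1) => /eqP.
  - have := h xl; rewrite Bl !inE eqxx orbT /= tI tI1 => /(_ isT) /eqP.
    by rewrite (eqr_nat _ _ 0) => /eqP.
  - have := h xr; rewrite Br !inE eqxx !orbT /= tI tI1 => /(_ isT) /eqP.
    by rewrite (eqr_nat _ _ 0) => /eqP.
rewrite (iX.2 s A us mA) [LHS]big_seq [RHS]big_seq; apply: eq_bigr => x xs.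
by congr Pr; apply/seteqP; split => w /=; rewrite /B xs XY.
Qed.

End laws.

(** * Oscillation of one opinion *)

Lemma Pr_approx (d : measure_display) (T : measurableType d) (R : realType)
    (P : probability T R) (A A' B : set T) :
  measurable A -> measurable A' -> measurable B ->
  (forall w, A w -> ~ B w -> A' w) -> Pr P A <= Pr P A' + Pr P B.
Proof.
move=> mA mA' mB AA'; apply: le_trans (PrU_le P mA' mB).
apply: Pr_le => //; first exact: measurableU.
by move=> w Aw; have [Bw|nBw] := pselect (B w); [right|left; exact: AA'].
Qed.

Lemma measurable_circle_norm (R : realType) (d : measure_display)
    (T : measurableType d) (y : T -> R) :
  measurable_fun setT y -> measurable_fun setT (fun w => circle_norm (y w)).
Proof.
move=> my; apply: (measurableT_comp (@normr_measurable R setT)).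
exact: (measurableT_comp (@measurable_circle_repr R)).
Qed.

Lemma measurable_circle_norm_le (R : realType) (d : measure_display)
    (T : measurableType d) (y : T -> R) (e : R) :
  measurable_fun setT y -> measurable [set w | circle_norm (y w) <= e].
Proof.
move=> /measurable_circle_norm my.
rewrite (_ : [set w | _] = (fun w => circle_norm (y w)) @^-1` `]-oo, e]%classic).
  by rewrite -[X in measurable X]setTI; exact: my.
by apply/seteqP; split => w /=; rewrite in_itv.
Qed.

(** The finite horizon [n] brings oscillation within reach of [automaton_approx]; [steadyE] removes
    it. *)
Definition steady_upto (R : realType) (K n : nat) (e : R) (y : nat -> R) : Prop :=
  forall j k, (K <= j <= n)%N -> (K <= k <= n)%N -> circle_norm (y j - y k) <= e.

Definition steady (R : realType) (K : nat) (e : R) (y : nat -> R) : Prop :=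
  forall j k, (K <= j)%N -> (K <= k)%N -> circle_norm (y j - y k) <= e.

Lemma measurable_steady_upto (R : realType) (d : measure_display)
    (T : measurableType d) (y : nat -> T -> R) K n (e : R) :
  (forall k, measurable_fun setT (y k)) ->
  measurable [set w | steady_upto K n e (fun k => y k w)].
Proof.
move=> my.
rewrite (_ : [set w | _] = \bigcap_j \bigcap_k
  (if (K <= j <= n)%N && (K <= k <= n)%N then
     [set w | circle_norm (y j w - y k w) <= e] else setT)).
  apply: bigcapT_measurable => j; apply: bigcapT_measurable => k; case: ifP => // _.
  by apply: measurable_circle_norm_le; exact: measurable_funB.
apply/seteqP; split => w /=.
  by move=> H j _ k _; case: ifP => // /andP[hj hk]; exact: H.
by move=> H j k hj hk; have := H j I k I; rewrite hj hk.
Qed.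

(** The distance to 2Z of a multiple of 2/M is 2/M times the absolute value of an integer, here [b];
    it is nonzero because 0 < |j - j'| < M prevents M from dividing j - j'. *)
Lemma circle_norm_spaced (R : realType) (M j j' : nat) :
  (j < M)%N -> (j' < M)%N -> j != j' ->
  2 / M%:R <= circle_norm (2 * j%:R / M%:R - 2 * j'%:R / M%:R) :> R.
Proof.
move=> jM j'M jj; have M0 : (0 < M)%N by lia.
have MR : 0 < M%:R :> R by rewrite ltr0n.
rewrite /circle_norm; have [z ->] := circle_reprE (2 * j%:R / M%:R - 2 * j'%:R / M%:R : R).
pose b := j%:Z - j'%:Z - z * M%:Z.
have -> : 2 * j%:R / M%:R - 2 * j'%:R / M%:R - 2 * z%:~R = 2 / M%:R * b%:~R :> R.
  by rewrite /b !intrB intrM -!pmulrn; field; exact: lt0r_neq0.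
have b0 : b != 0.
  apply/eqP; rewrite /b => E; move/eqP: jj; apply.
  have [z0|zn0] := eqVneq z 0; first by move: E; rewrite z0; lia.
  by nia.
rewrite normrM (@ger0_norm _ (2 / M%:R)) ?divr_ge0//.
rewrite -[X in X <= _]mulr1 ler_wpM2l ?divr_ge0//.
by rewrite -intr_norm ler1z -gtz0_ge1 normr_gt0.
Qed.

Section oscillation.
Context (R : realType) (d : measure_display) (T : measurableType d)
  (P : probability T R) (mu : R)
  (N : int -> R -> {RV P >-> nat}) (coin : int -> nat -> {RV P >-> bool})
  (eta : R -> int -> {RV P >-> R}).
Hypothesis heta : compass_model mu N coin eta.
Hypothesis heta0 : iid_uniform (eta 0).

Local Notation src t w := (fun x : source_index => source N coin eta t x w).
Local Notation space J := (g_sigma_algebraType (@cylinders _ R J)).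
Local Notation Y v w := (fun k : nat => eta k%:R v w).

Lemma measurable_cylinders_sub (J J' : set source_index) (D : set (source_index -> R)) :
  J `<=` J' -> (measurable : set_system (space J)) D ->
  (measurable : set_system (space J')) D.
Proof.
move=> JJ'; apply: sub_sigma_algebra2.
by move=> _ [s [A [us sJ mA ->]]]; exists s, A; split => // i /sJ /JJ'.
Qed.

Lemma measurable_fun_automaton k v :
  measurable_fun [set: space setT] (fun f : space setT => automaton mu f k v).
Proof.
move=> _ A mA; rewrite setTI; apply: (@measurable_cylinders_sub (past k)) => //.
by have := @measurable_automaton R mu k k v (leqnn k) measurableT _ mA; rewrite setTI.
Qed.

Lemma measurable_eta k v : measurable_fun setT (fun w => eta k%:R v w).
Proof. exact: measurable_funPT. Qed.

Lemma measurable_source_event m (D : set (source_index -> R)) :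
  (measurable : set_system (space setT)) D ->
  measurable [set w | D (src (mesh R m) w)].
Proof. exact: (measurable_family (mesh_independent heta heta0 m).1). Qed.

(** Both sides are compared with the automaton on a common mesh, where shift invariance is exact;
    the total error [del] is arbitrary. *)
Lemma steady_upto_shift_le K n e v v' :
  Pr P [set w | steady_upto K n e (Y v w)] <= Pr P [set w | steady_upto K n e (Y v' w)].
Proof.
apply/ler_addgt0Pr => del del0.
have del2 : 0 < del / 2 by rewrite divr_gt0.
have [m Hm] := automaton_approx heta heta0 n del2.
have [B [mB PB] HB] := Hm v; have [B' [mB' PB'] HB'] := Hm v'.
pose D u : set (space setT) := [set f : space setT |
  steady_upto K n e (fun k => automaton mu f (k * m.+1) u)].
have mD u : measurable (D u).
  by apply: measurable_steady_upto => k; exact: measurable_fun_automaton.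
have mY u : measurable [set w | steady_upto K n e (Y u w)].
  by apply: measurable_steady_upto => k; exact: measurable_eta.
have mX u : measurable [set w | D u (src (mesh R m) w)].
  by apply: measurable_source_event; exact: mD.
have h1 : Pr P [set w | steady_upto K n e (Y v w)] <=
    Pr P [set w | D v (src (mesh R m) w)] + Pr P B.
  apply: Pr_approx => // w H nB j k hj hk.
  by have := H j k hj hk; rewrite !HB //; [case/andP: hk|case/andP: hj].
have h2 : Pr P [set w | D v' (src (mesh R m) w)] <=
    Pr P [set w | steady_upto K n e (Y v' w)] + Pr P B'.
  apply: Pr_approx => // w H nB j k hj hk.
  by rewrite !HB'//; [exact: H|case/andP: hk|case/andP: hj].
have h3 : Pr P [set w | D v (src (mesh R m) w)] = Pr P [set w | D v' (src (mesh R m) w)].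
  rewrite (source_shift_law heta heta0 m (v' - v) (mD v)); congr Pr.
  have vv : v + (v' - v) = v' by rewrite addrC subrK.
  by apply/seteqP; split => w H j k hj hk; have := H j k hj hk;
    rewrite !automaton_shift vv.
by rewrite h3 in h1; lra.
Qed.

Lemma steady_upto_shift K n e v v' :
  Pr P [set w | steady_upto K n e (Y v w)] = Pr P [set w | steady_upto K n e (Y v' w)].
Proof. by apply/eqP; rewrite eq_le !steady_upto_shift_le. Qed.

Lemma steadyE K e v : [set w | steady K e (Y v w)] =
  \bigcap_n [set w | steady_upto K n e (Y v w)].
Proof.
apply/seteqP; split => w /=.
  by move=> H n _ j k /andP[Kj _] /andP[Kk _]; exact: H.
move=> H j k Kj Kk; apply: (H (maxn j k) I); rewrite ?Kj ?Kk /=; lia.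
Qed.

Lemma measurable_steady K e v : measurable [set w | steady K e (Y v w)].
Proof.
rewrite steadyE; apply: bigcapT_measurable => n.
by apply: measurable_steady_upto => k; exact: measurable_eta.
Qed.

Lemma steady_shift K e v v' :
  Pr P [set w | steady K e (Y v w)] = Pr P [set w | steady K e (Y v' w)].
Proof.
have lim u : Pr P [set w | steady_upto K n e (Y u w)] @[n --> \oo] -->
    Pr P [set w | steady K e (Y u w)].
  rewrite steadyE; apply: Pr_cvg_down.
    by move=> n; apply: measurable_steady_upto => k; exact: measurable_eta.
  move=> n n' nn'; apply/subsetPset => w H j k hj hk; apply: H; lia.
apply: (cvg_unique _ (lim v)) => //=.
by under eq_fun do rewrite (steady_upto_shift _ _ _ v v'); exact: lim.
Qed.

Definition eventually_steady e v : set T := \bigcup_K [set w | steady K e (Y v w)].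

Lemma measurable_eventually_steady e v : measurable (eventually_steady e v).
Proof. by apply: bigcupT_measurable => K; exact: measurable_steady. Qed.

Lemma eventually_steady_cvg e v :
  Pr P [set w | steady K e (Y v w)] @[K --> \oo] --> Pr P (eventually_steady e v).
Proof.
apply: Pr_cvg_up; first by move=> K; exact: measurable_steady.
by move=> K K' KK'; apply/subsetPset => w H j k hj hk; apply: H; lia.
Qed.

(** The probability of oscillating by at most [e] from time [K] on is the same at all vertices, and
    so is its limit in [K]. A [K] chosen at one vertex therefore serves all. *)
Lemma uniform_steady (e : R) (v : int) (del : R) : 0 < del ->
  exists K, forall v',
    Pr P (eventually_steady e v' `\` [set w | steady K e (Y v' w)]) <= del.
Proof.
move=> del0; have /cvgr_ge := @eventually_steady_cvg e v.
move=> /(_ (Pr P (eventually_steady e v) - del)) []; first by lra.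
move=> K _ /(_ K (leqnn K)) /= HK; exists K => v'.
have eqv : Pr P (eventually_steady e v') = Pr P (eventually_steady e v).
  apply: (cvg_unique _ (@eventually_steady_cvg e v')) => //=.
  by under eq_fun do rewrite (steady_shift _ _ v' v); exact: eventually_steady_cvg.
have := Pr_split P (measurable_eventually_steady e v') (measurable_steady K e v').
rewrite (_ : _ `&` _ = [set w | steady K e (Y v' w)]); last first.
  apply/seteqP; split => w; first by case.
  by move=> H; split => //; exists K.
by rewrite eqv (steady_shift _ _ v' v); lra.
Qed.

(** Rotations by 2j/M for j < M turn the closeness event of the automaton into M disjoint events of
    equal probability, hence at most 1/M; [del] pays for the approximation. *)
Lemma rarely_close k v (M : nat) (e del : R) : (0 < M)%N -> e < M%:R^-1 -> 0 < del ->
  exists n : nat, Pr P [set w | circle_norm (Y v w k - Y (v + n%:Z) w k) <= e] <=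
    M%:R^-1 + del.
Proof.
move=> M0 eM del0.
have del2 : 0 < del / 2 by rewrite divr_gt0.
have [m Hm] := automaton_approx heta heta0 k del2.
(* The domains of dependence, of radius [i] around [v] and [v + n], are disjoint. *)
pose i := (k * m.+1)%N; pose n := (2 * i).+1; exists n.
have [B [mB PB] HB] := Hm v; have [B' [mB' PB'] HB'] := Hm (v + n%:Z).
pose D c : set (space setT) := [set f : space setT |
  circle_norm (automaton mu f i v + c - automaton mu f i (v + n%:Z)) <= e].
have mD c : measurable (D c).
  apply: measurable_circle_norm_le; apply: measurable_funB.
    by apply: measurable_funD => //; exact: measurable_fun_automaton.
  exact: measurable_fun_automaton.
have mX c : measurable [set w | D c (src (mesh R m) w)].
  by apply: measurable_source_event; exact: mD.
have h1 : Pr P [set w | circle_norm (Y v w k - Y (v + n%:Z) w k) <= e] <=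
    Pr P [set w | D 0 (src (mesh R m) w)] + Pr P (B `|` B').
  apply: Pr_approx => //.
  - by apply: measurable_circle_norm_le; apply: measurable_funB; exact: measurable_eta.
  - exact: measurableU.
  move=> w /= H /not_orP[nB nB']; rewrite /D /= addr0.
  by rewrite -HB// -HB'.
have hU := PrU_le P mB mB'.
pose c (j : nat) : R := 2 * j%:R / M%:R.
have MR : 0 < M%:R :> R by rewrite ltr0n.
have rot j : (j < M)%N -> Pr P [set w | D (c j) (src (mesh R m) w)] =
    Pr P [set w | D 0 (src (mesh R m) w)].
  (* This half-line contains the domain of [v], which ends at [v + i], and misses that of [v + n],
     which begins at [v + i + 1]. *)
  move=> jM; pose A : pred int := fun u => u <= v + i%:Z.
  have c02 : 0 <= c j < 2.
    rewrite /c; apply/andP; split; first by rewrite divr_ge0// mulr_ge0.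
    by rewrite ltr_pdivrMr// ltr_pM2l// ltr_nat.
  have e1 f : automaton mu (rotate_sources (c j) A f) i v =
      circle_repr (automaton mu f i v + c j).
    by apply: automaton_rotate => u; rewrite /A; clearbody i; lia.
  have e2 f : automaton mu (rotate_sources (c j) A f) i (v + n%:Z) =
      automaton mu f i (v + n%:Z).
    by apply: automaton_rotate0 => u; rewrite /A /n; clearbody i; lia.
  rewrite -(source_rotate_law heta heta0 m A c02 (mD 0)); congr Pr.
  by apply/seteqP; split => w; rewrite /D /mkset e1 e2 addr0 circle_norm_reprD.
(* If two of the events met, their angles would be within 2e < 2/M of each other, less than their
   spacing. *)
have disj (j j' : 'I_M) w : D (c j) (src (mesh R m) w) -> D (c j') (src (mesh R m) w) -> j = j'.
  rewrite /D /=; set a := automaton _ _ _ _; set b := automaton _ _ _ _ => H H'.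
  have : circle_norm (c j - c j') <= e + e.
    apply: le_trans (lerD H H').
    rewrite (_ : c j - c j' = (a + c j - b) + - (a + c j' - b)); last by ring.
    by apply: le_trans (circle_normD _ _) _; rewrite circle_normN.
  move=> cle; apply/val_inj/eqP; apply: contraT => jj.
  have := circle_norm_spaced R (ltn_ord j) (ltn_ord j') jj.
  have : 2 * e < 2 / M%:R by rewrite ltr_pM2l.
  by rewrite -/(c j) -/(c j'); lra.
have mc (j : 'I_M) : measurable [set w | D (c j) (src (mesh R m) w)] by [].
have := @Pr_bigU _ _ _ P _ (enum 'I_M) (fun j : 'I_M => [set w | D (c j) (src (mesh R m) w)])
  (enum_uniq _) mc disj.
rewrite (eq_bigr (fun=> Pr P [set w | D 0 (src (mesh R m) w)])); last by move=> j _; exact: rot.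
rewrite big_const_seq count_predT size_enum_ord.
have -> (x : R) : iter M (+%R x) 0 = M%:R * x by rewrite iter_addr addr0 mulr_natl.
move=> E; have : M%:R * Pr P [set w | D 0 (src (mesh R m) w)] <= 1.
  rewrite E -(PrT P); apply: Pr_le => //; exact: bigsetU_measurable.
rewrite -ler_pdivlMl// mulr1; lra.
Qed.

End oscillation.

(** * Conditional Borel-Cantelli *)

(* At the times [m], ..., [m + l - 1], [a] and [s] never hold together although
   [a] holds at least [r] times. *)
Fixpoint missed (a s : nat -> Prop) (l m r : nat) : Prop :=
  if l is l'.+1 then
    (~ a m /\ missed a s l' m.+1 r) \/ (a m /\ ~ s m /\ missed a s l' m.+1 r.-1)
  else r = 0%N.

Lemma missed_ext (a s a' s' : nat -> Prop) l m r :
  (forall j, (m <= j < m + l)%N -> (a j <-> a' j) /\ (s j <-> s' j)) ->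
  missed a s l m r -> missed a' s' l m r.
Proof.
elim: l m r => //= l ih m r H.
have [[aa' a'a] [ss' s's]] := H m ltac:(lia).
have H' j : (m.+1 <= j < m.+1 + l)%N -> (a j <-> a' j) /\ (s j <-> s' j).
  by move=> jl; apply: H; lia.
by case=> [[na]|[am [ns]]] /(ih _ _ H') ?; [left|right]; intuition.
Qed.

(** As long as no hit ever occurs, a longer run keeps the event; this monotonicity in [l] is what
    continuity from below requires. *)
Lemma missed_extend (a s : nat -> Prop) l m r :
  (forall j, (m <= j)%N -> a j -> ~ s j) -> missed a s l m r -> missed a s l.+1 m r.
Proof.
elim: l m r => [|l ih] m r H.
  move=> -> /=; have [am|nam] := pselect (a m); [right|by left].
  by split => //; split => //; exact: H (leqnn m) am.
have H' j : (m.+1 <= j)%N -> a j -> ~ s j by move=> jl; apply: H; lia.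
case=> [[nam /(ih _ _ H') h]|[am [ns /(ih _ _ H') h]]]; first by left.
by right; split => //; split.
Qed.

Lemma missed_often (a s : nat -> Prop) m r :
  (forall j, (m <= j)%N -> a j -> ~ s j) ->
  (forall i, exists2 j, (i <= j)%N & a j) -> exists l, missed a s l m r.
Proof.
move=> + io; elim: r m => [|r ih] m H; first by exists 0%N.
have [j mj aj] := io m.
(* Inner induction on the distance [p] to a time at which [a] holds. An earlier occurrence of [a] is
   counted at once and handed to the outer induction. *)
suff : forall p m', (forall j, (m' <= j)%N -> a j -> ~ s j) -> j = (m' + p)%N ->
    exists l, missed a s l m' r.+1 by move=> /(_ (j - m)%N m H); apply; lia.
elim=> [|p ihp] m' Hm' jE.
  have am' : a m' by move: aj; rewrite jE addn0.
  have [l hl] := ih m'.+1 (fun i mi => Hm' i (ltnW mi)).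
  by exists l.+1; right; split => //; split => //; exact: Hm' (leqnn m') am'.
have [l hl] := ihp m'.+1 (fun i mi => Hm' i (ltnW mi)) ltac:(lia).
have [am'|nam'] := pselect (a m'); last by exists l.+1; left.
have [l' hl'] := ih m'.+1 (fun i mi => Hm' i (ltnW mi)).
by exists l'.+1; right; split => //; split => //; exact: Hm' (leqnn m') am'.
Qed.

Section conditional_borel_cantelli.
Context (d : measure_display) (T : measurableType d) (R : realType)
  (P : probability T R) (F : nat -> set_system T) (A S : nat -> set T) (q : R).
Hypothesis Fm : forall k, F k `<=` measurable.
Hypothesis Fnd : forall k, F k `<=` F k.+1.
Hypothesis FI : forall k B C, F k B -> F k C -> F k (B `&` C).
Hypothesis FC : forall k B, F k B -> F k (~` B).
Hypothesis FA : forall k, F k (A k).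
Hypothesis FSk : forall k, F k.+1 (S k).
Hypothesis indep : forall k D, F k D -> Pr P (D `&` S k) = q * Pr P D.
Hypothesis q1 : 0 <= q <= 1.

Let miss l m r := [set w | missed (fun j => A j w) (fun j => S j w) l m r].

Let missS l m r : miss l.+1 m r =
  (~` A m `&` miss l m.+1 r) `|` ((A m `&` ~` S m) `&` miss l m.+1 r.-1).
Proof.
apply/seteqP; split => w; rewrite /miss /mkset /=; first by case=> [[? ?]|[? []]]; [left|right].
by case=> [[? ?]|[[? ?] ?]]; [left|right].
Qed.

Lemma measurable_missed l m r : measurable (miss l m r).
Proof.
elim: l m r => [|l ih] m r.
  by case: r => [|r]; [rewrite (_ : miss _ _ _ = setT)|rewrite (_ : miss _ _ _ = set0)];
    rewrite //; apply/seteqP; split.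
have mA k : measurable (A k) by apply: Fm (FA k).
have mS k : measurable (S k) by apply: Fm (FSk k).
rewrite missS; apply: measurableU; apply: measurableI => //; first exact: measurableC.
by apply: measurableI => //; exact: measurableC.
Qed.

(** Condition on time [m]: off [A m] nothing is spent; on [A m] the failure of [S m], independent of
    [F m], costs a factor [1 - q] and one unit of [r]. The past [D] is general so that the induction
    can absorb these events. *)
Lemma Pr_missed_le l m r D : F m D -> Pr P (D `&` miss l m r) <= (1 - q) ^+ r * Pr P D.
Proof.
move: q1 => /andP[q0 q1'].
elim: l m r D => [|l ih] m [|r] D FD.
- rewrite expr0 mul1r; apply: Pr_le; [|exact: Fm FD|by move=> w []].
  by apply: measurableI; [exact: Fm FD|exact: measurable_missed].
- rewrite (_ : _ `&` _ = set0) ?Pr0 ?mulr_ge0 ?exprn_ge0 ?subr_ge0 ?Pr_ge0//.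
  by apply/seteqP; split => w //= [].
- rewrite expr0 mul1r; apply: Pr_le; [|exact: Fm FD|by move=> w []].
  by apply: measurableI; [exact: Fm FD|exact: measurable_missed].
have FD1 : F m (D `&` ~` A m) by apply: FI => //; exact: FC.
have FD2 : F m (D `&` A m) by apply: FI.
have FD3 : F m.+1 ((D `&` A m) `&` ~` S m).
  by apply: FI; [exact: Fnd|apply: FC; exact: FSk].
have mm := @measurable_missed.
have h1 := ih m.+1 r.+1 _ (Fnd FD1); have h2 := ih m.+1 r _ FD3.
have e1 := Pr_split P (Fm FD) (Fm (FA m)).
have e2 := Pr_split P (Fm FD2) (Fm (FSk m)).
rewrite indep// in e2.
have := @PrU_le _ _ _ P (D `&` ~` A m `&` miss l m.+1 r.+1)
  (((D `&` A m) `&` ~` S m) `&` miss l m.+1 r).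
rewrite (_ : _ `|` _ = D `&` miss l.+1 m r.+1); last first.
  by rewrite missS /= setIUr !setIA.
move=> /(_ (measurableI _ _ (Fm FD1) (mm _ _ _)) (measurableI _ _ (Fm FD3) (mm _ _ _))) h3.
apply: le_trans h3 _; apply: le_trans (lerD h1 h2) _.
rewrite -!setDE in e1 e2 *.
have -> : Pr P (D `&` A m `\` S m) = (1 - q) * Pr P (D `&` A m) by lra.
by rewrite mulrA -exprSr e1 mulrDr addrC.
Qed.

End conditional_borel_cantelli.

(** * Neighbours agree *)

Definition circle_cauchy (R : realType) (y : nat -> R) : Prop :=
  forall e, 0 < e -> exists K, steady K e y.

Lemma expRN1_cube_itv (R : realType) : 0 < (expR (-1) : R) ^+ 3 < 1.
Proof.
have : expR (-1) < 1 :> R by rewrite expR_lt1 ltrN10.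
have := expR_gt0 (-1 : R); set x := expR _ => x0 x1.
by rewrite exprn_gt0// exprn_ilt1// ltW.
Qed.


Section local_consensus.
Context (R : realType) (d : measure_display) (T : measurableType d)
  (P : probability T R) (mu : R)
  (N : int -> R -> {RV P >-> nat}) (coin : int -> nat -> {RV P >-> bool})
  (eta : R -> int -> {RV P >-> R}).
Hypothesis heta : compass_model mu N coin eta.
Hypothesis heta0 : iid_uniform (eta 0).

Local Notation src t w := (fun x : source_index => source N coin eta t x w).
Local Notation space J := (g_sigma_algebraType (@cylinders _ R J)).
Local Notation Y v w := (fun k : nat => eta k%:R v w).
Local Notation q := (expR (-1) ^+ 3 : R).

Section mesh_block.
Context (m : nat).

(** The increment over a unit of time in terms of the mesh, so that a solo event is determined by
    the cells before its end. On a good path the counters are monotone and the sum telescopes. *)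
Definition block_sum (f : source_index -> R) (e : int) (k : nat) : R :=
  \sum_(k * m.+1 <= i < k.+1 * m.+1) f (inl (inr (e, i))).

Definition solo_block (v : int) (k : nat) : set (source_index -> R) :=
  [set f | [/\ block_sum f v k = 1, block_sum f (v - 1) k = 0 & block_sum f (v + 1) k = 0]].

Lemma block_sum_incr w e k : good_path mu N coin eta w ->
  block_sum (src (mesh R m) w) e k = (N e k.+1%:R w - N e k%:R w)%N%:R.
Proof.
move=> gw; have meshE j : mesh R m (j * m.+1) = j%:R by rewrite /mesh natrM mulfK.
rewrite /block_sum /= -natr_sum (@telescope_sumn_in _ _ (fun i => N e (mesh R m i) w)) ?meshE//.
  by rewrite leq_mul2r leqnSn orbT.
move=> i _; apply: (good_mono gw); [exact: mesh_ge0|exact/ltW/meshS].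
Qed.

Lemma solo_blockE w v k : good_path mu N coin eta w ->
  solo_block v k (src (mesh R m) w) <-> solo_event N v k%:R k.+1%:R w.
Proof.
move=> gw; rewrite /solo_block /solo_event /= !(block_sum_incr _ _ gw).
split=> [[/eqP h1 /eqP h2 /eqP h3]|[-> -> ->]//].
by move: h1 h2 h3; rewrite (eqr_nat _ _ 1) !(eqr_nat _ _ 0) => /eqP ? /eqP ? /eqP ?.
Qed.

Lemma measurable_solo_block v k :
  (measurable : set_system (space (past (k.+1 * m.+1)))) (solo_block v k).
Proof.
have mb e (c : R) : (measurable : set_system (space (past (k.+1 * m.+1))))
    [set f | block_sum f e k = c].
  have mf : measurable_fun [set: space (past (k.+1 * m.+1))]
      (fun f : space (past (k.+1 * m.+1)) => block_sum f e k).
    have -> : (fun f : space (past (k.+1 * m.+1)) => block_sum f e k) =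
       (fun f => \sum_(i <- index_iota (k * m.+1) (k.+1 * m.+1) | (i < k.+1 * m.+1)%N)
         f (inl (inr (e, i)))).
      apply/funext => f; rewrite /block_sum big_seq_cond [RHS]big_seq_cond.
      apply: eq_bigl => i; rewrite mem_index_iota.
      by case: (i < _)%N; rewrite ?andbF ?andbT.
    rewrite (_ : (fun _ => _) = (fun f : space (past (k.+1 * m.+1)) =>
      \sum_(i <- index_iota (k * m.+1) (k.+1 * m.+1))
        if (i < k.+1 * m.+1)%N then f (inl (inr (e, i))) else 0)); last first.
      by apply/funext => f; rewrite big_mkcond.
    apply: measurable_sum => i; case ik : (i < k.+1 * m.+1)%N => //.
    exact: (@measurable_coordinate _ R (past (k.+1 * m.+1)) (inl (inr (e, i)))).
  by have := mf measurableT _ (measurable_set1 c); rewrite setTI.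
rewrite (_ : solo_block v k = [set f | block_sum f v k = 1] `&`
  ([set f | block_sum f (v - 1) k = 0] `&` [set f | block_sum f (v + 1) k = 0])).
  by apply: (@measurableI _ (space _)) => //; apply: (@measurableI _ (space _)).
by apply/seteqP; split => f /=; [case|case=> ? []].
Qed.

End mesh_block.

Lemma measurable_far v (e : R) k :
  measurable [set w | e < circle_norm (Y v w k - Y (v + 1) w k)].
Proof.
rewrite (_ : [set w | _] = ~` [set w | circle_norm (Y v w k - Y (v + 1) w k) <= e]); last first.
  apply/seteqP; split => w /=; last by move/negP; rewrite -ltNge.
  by move=> h; apply/negP; rewrite -ltNge.
apply: measurableC; apply: measurable_circle_norm_le.
by apply: measurable_funB; exact: measurable_eta.
Qed.

Lemma measurable_missed_eta (v : int) (e : R) (l m0 r : nat) :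
  measurable [set w | missed (fun j => e < circle_norm (Y v w j - Y (v + 1) w j))
    (fun j => solo_event N v j%:R j.+1%:R w) l m0 r].
Proof.
(* The constant filtration of all measurable sets serves here, as only measurability is at stake. *)
apply: (@measurable_missed d T (fun=> measurable)
  (fun k => [set w | e < circle_norm (Y v w k - Y (v + 1) w k)])
  (fun k => solo_event N v k%:R k.+1%:R)) => // k.
- by [].
- exact: measurable_far.
- exact: measurable_solo_event.
Qed.

(** Exact independence from the past holds for events of the automaton. The mesh is chosen after the
    horizon [m0 + l], and the error [del] is sent to 0 with [l] fixed. *)
Lemma Pr_missed (v : int) (e : R) (l m0 r : nat) :
  Pr P [set w | missed (fun j => e < circle_norm (Y v w j - Y (v + 1) w j))
    (fun j => solo_event N v j%:R j.+1%:R w) l m0 r] <= (1 - q) ^+ r.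
Proof.
have /andP[q0 q1] := expRN1_cube_itv R.
apply/ler_addgt0Pr => del del0.
have del2 : 0 < del / 2 by rewrite divr_gt0.
have [m Hm] := automaton_approx heta heta0 (m0 + l) del2.
have [B [mB PB] HB] := Hm v; have [B' [mB' PB'] HB'] := Hm (v + 1).
have [Z [mZ PZ] HZ] := ae_null (ae_good_path heta).
pose X w := src (mesh R m) w.
pose A' k := [set w | e < circle_norm (automaton mu (X w) (k * m.+1) v -
  automaton mu (X w) (k * m.+1) (v + 1))].
pose S' k := [set w | solo_block m v k (X w)].
(* Events determined by the initial opinions, the coins and the cells before time [k]. *)
pose F k : set_system T := [set C | exists2 D, (measurable : set_system
  (space (past (k * m.+1)))) D & C = [set w | D (X w)]].
have mX : forall i, measurable_fun setT (source N coin eta (mesh R m) i).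
  exact: (mesh_independent heta heta0 m).1.
have Fm k : F k `<=` measurable.
  by move=> _ [D mD ->]; exact: (measurable_family mX mD).
have FA k : F k (A' k).
  exists [set f | e < circle_norm (automaton mu f (k * m.+1) v -
    automaton mu f (k * m.+1) (v + 1))] => //.
  rewrite (_ : [set f | _] = ~` [set f | circle_norm (automaton mu f (k * m.+1) v -
    automaton mu f (k * m.+1) (v + 1)) <= e]); last first.
    apply/seteqP; split => f /=; last by move/negP; rewrite -ltNge.
    by move=> h; apply/negP; rewrite -ltNge.
  apply: (@measurableC _ (space (past (k * m.+1)))).
  by apply: measurable_circle_norm_le; apply: measurable_funB;
    exact: measurable_automaton.
have FS k : F k.+1 (S' k) by exists (solo_block m v k) => //; exact: measurable_solo_block.
have mM := @measurable_missed d T F A' S' Fm FA FS l m0 r.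
have indep k D : F k D -> Pr P (D `&` S' k) = q * Pr P D.
  move=> [D0 mD0 ->]; rewrite -(solo_event_independent heta heta0 v mD0).
  have mD := measurable_family mX mD0.
  have mS : measurable (S' k) by apply: (Fm k.+1).
  have mE := measurable_solo_event N v k%:R k.+1%:R.
  apply/eqP; rewrite eq_le; apply/andP; split.
    rewrite -[X in _ <= X]addr0 -PZ; apply: Pr_approx => //; do ?exact: measurableI.
    by move=> w [Dw Sw] nZ; split => //; apply/(solo_blockE m v k (HZ w nZ)).
  rewrite -[X in _ <= X]addr0 -PZ; apply: Pr_approx => //; do ?exact: measurableI.
  by move=> w [Dw Sw] nZ; split => //; apply/(solo_blockE m v k (HZ w nZ)).
have := @Pr_missed_le d T R P F A' S' q Fm.
move=> /(_ _ _ _ FA FS indep _ l m0 r setT).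
have q01 : 0 <= q <= 1 by rewrite !ltW.
have FTT k : F k setT by exists setT => //; exact: (@measurableT _ (space _)).
rewrite setTI PrT mulr1.
move=> bound.
have {bound} bound : Pr P [set w | missed (A' ^~ w) (S' ^~ w) l m0 r] <= (1 - q) ^+ r.
  apply: bound => //.
  - move=> k _ [D mD ->]; exists D => //; apply: measurable_cylinders_sub mD.
    move=> [[u|[a i]]|[a i]] //= ik; apply: leq_trans ik _.
    by rewrite leq_mul2r leqnSn orbT.
  - move=> k _ _ [D mD ->] [D' mD' ->]; exists (D `&` D') => //.
    exact: (@measurableI _ (space _)).
  - by move=> k _ [D mD ->]; exists (~` D) => //; exact: (@measurableC _ (space _)).
apply: (@le_trans _ _ (Pr P [set w | missed (A' ^~ w) (S' ^~ w) l m0 r] + Pr P (Z `|` (B `|` B')))).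
  apply: Pr_approx => //.
  - exact: measurable_missed_eta.
  - by apply: measurableU => //; exact: measurableU.
  move=> w H /not_orP[nZ /not_orP[nB nB']]; apply: missed_ext H => j jl.
  have jL : (j <= m0 + l)%N by lia.
  rewrite /A' /X /= -HB// -HB'//; split => //.
  by split => /(solo_blockE m v j (HZ w nZ)).
have h1 := PrU_le P mZ (measurableU _ _ mB mB'); have h2 := PrU_le P mB mB'.
lra.
Qed.

End local_consensus.

(** * From neighbours to distant vertices, and the contradiction *)

Section consensus.
Context (R : realType) (d : measure_display) (T : measurableType d)
  (P : probability T R) (mu : R)
  (N : int -> R -> {RV P >-> nat}) (coin : int -> nat -> {RV P >-> bool})
  (eta : R -> int -> {RV P >-> R}).
Hypothesis hmu : 0 < mu <= 2^-1.
Hypothesis heta : compass_model mu N coin eta.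
Hypothesis heta0 : iid_uniform (eta 0).

Local Notation Y v w := (fun k : nat => eta k%:R v w).
Local Notation q := (expR (-1) ^+ 3 : R).
Local Notation far v e w := (fun j : nat => e < circle_norm (Y v w j - Y (v + 1) w j)).
Local Notation solo v w := (fun j : nat => solo_event N v j%:R j.+1%:R w).

(** On the event [G] that no far time from [m] on comes with a solo event, missing [r] times
    increases with the length of the run. Continuity from below removes the length, and then [r]
    tends to infinity. *)
Lemma ae_not_missed (v : int) (e : R) (m : nat) : \forall w \ae P,
  ~ ((forall j, (m <= j)%N -> far v e w j -> ~ solo v w j) /\
     (forall i, exists2 j, (i <= j)%N & far v e w j)).
Proof.
pose G := \bigcap_(j in [set j | (m <= j)%N])
  ~` ([set w | far v e w j] `&` solo_event N v j%:R j.+1%:R).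
have mG : measurable G.
  apply: bigcap_measurableType => j _; apply: measurableC; apply: measurableI.
    exact: measurable_far.
  exact: measurable_solo_event.
pose U r := \bigcup_l (G `&` [set w | missed (far v e w) (solo v w) l m r]).
have mM l r : measurable [set w | missed (far v e w) (solo v w) l m r].
  exact: measurable_missed_eta.
have mU r : measurable (U r).
  by apply: bigcupT_measurable => l; exact: measurableI.
have GP w : G w <-> forall j, (m <= j)%N -> far v e w j -> ~ solo v w j.
  split=> [Gw j mj aj sj|H j mj [aj sj]]; first by apply: (Gw j mj).
  exact: H mj aj sj.
have PU r : Pr P (U r) <= (1 - q) ^+ r.
  have cv : Pr P (G `&` [set w | missed (far v e w) (solo v w) l m r]) @[l --> \oo]
      --> Pr P (U r).
    apply: Pr_cvg_up; first by move=> l; exact: measurableI.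
    apply/nondecreasing_seqP => l; apply/subsetPset => w [Gw H]; split => //.
    by apply: missed_extend H; exact/GP.
  rewrite -(cvg_lim _ cv)//; apply: limr_le; first by apply/cvg_ex; eexists; exact: cv.
  apply: nearW => l; apply: le_trans (Pr_missed heta heta0 v e l m r).
  by apply: Pr_le; [exact: measurableI|exact: mM|move=> w []].
have P0 : Pr P (\bigcap_r U r) = 0.
  have mI : measurable (\bigcap_r U r) by exact: bigcapT_measurable.
  have /andP[q0 q1] := expRN1_cube_itv R.
  apply/eqP; rewrite eq_le Pr_ge0 andbT.
  have cq : (1 - q) ^+ r @[r --> \oo] --> 0 by apply: cvg_expr; rewrite ger0_norm; lra.
  rewrite -(cvg_lim _ cq)//; apply: limr_ge; first by apply/cvg_ex; eexists; exact: cq.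
  apply: nearW => r; apply: le_trans (PU r); apply: Pr_le => //.
  by move=> w; apply.
exists (\bigcap_r U r); split.
- exact: bigcapT_measurable.
- by rewrite PrE ?P0//; exact: bigcapT_measurable.
- move=> w /contrapT [H io] r _.
  have [l hl] := missed_often r H io.
  by exists l => //; split => //; exact/GP.
Qed.

Lemma solo_move (v : int) (w : T) (k : nat) : good_path mu N coin eta w ->
  solo v w k ->
  circle_norm (Y v w k.+1 - Y v w k) = mu * circle_norm (Y v w k - Y (v + 1) w k).
Proof.
move=> gw [h1 h2 h3].
have k0 : 0 <= k%:R :> R by [].
have kk : k%:R < k.+1%:R :> R by rewrite ltr_nat.
have mono e := good_mono gw e k0 (ltW kk).
have := one_event heta gw k0 kk (u := v).
have hv := mono v; have hl := mono (v - 1); have hr := mono (v + 1).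
rewrite -(compass_update_move (coin v (N v k.+1%:R w) w) _ _ hmu).
by move=> <- //=; lia.
Qed.

(** A far time with a solo event moves [v] by more than [mu] times the threshold, which a Cauchy
    path stops doing; [ae_not_missed] then rules out infinitely many far times. *)
Lemma neighbor_close (v : int) : \forall w \ae P, circle_cauchy (Y v w) ->
  forall e, 0 < e -> exists K, forall k, (K <= k)%N ->
    circle_norm (Y v w k - Y (v + 1) w k) <= e.
Proof.
(* Thresholds [i.+1%:R^-1] and starting times are countable, so one null set serves every [e] and
   [K]. *)
have hi i := ae_foralln (fun m => @ae_not_missed v i.+1%:R^-1 m).
have h := ae_foralln hi.
apply: filterS2 h (ae_good_path heta) => w H gw cauchy e e0.
have /andP[mu0 _] := hmu.
pose i := Num.truncn e^-1; pose e' : R := i.+1%:R^-1.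
have e'e : e' < e.
  by rewrite /e' invf_plt ?posrE ?ltr0n// truncnS_gt.
have e'0 : 0 < e' by rewrite invr_gt0.
have [K sK] := cauchy (mu * e') (mulr_gt0 mu0 e'0).
apply: contrapT => nK; apply: (H i K); split.
  move=> j Kj aj sj; have := sK j.+1 j (leqW Kj) Kj.
  by rewrite (solo_move gw sj) ler_pM2l// leNgt aj.
move=> K'; apply: contrapT => nj; apply: nK; exists K' => k Kk.
rewrite leNgt; apply/negP => ek; apply: nj; exists k => //.
exact: lt_trans ek.
Qed.

Lemma chain_close (v : int) (n : nat) : \forall w \ae P, circle_cauchy (Y v w) ->
  circle_cauchy (Y (v + n%:Z) w) /\
  forall e, 0 < e -> exists K, forall k, (K <= k)%N ->
    circle_norm (Y v w k - Y (v + n%:Z) w k) <= e.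
Proof.
elim: n => [|n ih].
  apply: aeW => w cauchy; rewrite addr0; split => // e e0; exists 0%N => k _.
  rewrite subrr circle_norm_small normr0 ?ler01//; exact: ltW.
apply: filterS2 ih (neighbor_close (v + n%:Z)) => w ih nc cauchy.
have [cn close] := ih cauchy; have := nc cn.
have -> : v + n%:Z + 1 = v + n.+1%:Z by lia.
move=> {}nc; split.
  move=> e e0; have e3 : 0 < e / 3 by rewrite divr_gt0.
  have [K1 h1] := cn _ e3; have [K2 h2] := nc _ e3.
  exists (maxn K1 K2) => j k; rewrite !geq_max => /andP[j1 j2] /andP[k1 k2].
  have := h1 j k j1 k1; have := h2 j j2; have := h2 k k2.
  have := circle_norm_triangle (Y (v + n%:Z) w j) (Y (v + n.+1%:Z) w j) (Y (v + n.+1%:Z) w k).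
  have := circle_norm_triangle (Y (v + n%:Z) w k) (Y (v + n%:Z) w j) (Y (v + n.+1%:Z) w k).
  rewrite (circle_normC (Y (v + n.+1%:Z) w j) (Y (v + n%:Z) w j)); lra.
move=> e e0; have e2 : 0 < e / 2 by rewrite divr_gt0.
have [K1 h1] := close _ e2; have [K2 h2] := nc _ e2.
exists (maxn K1 K2) => k; rewrite !geq_max => /andP[k1 k2].
have := h1 k k1; have := h2 k k2.
have := circle_norm_triangle (Y (v + n%:Z) w k) (Y v w k) (Y (v + n.+1%:Z) w k).
lra.
Qed.

Definition cauchy_event (v : int) : set T := \bigcap_i eventually_steady eta i.+1%:R^-1 v.

Lemma cauchy_eventP v w : cauchy_event v w <-> circle_cauchy (Y v w).
Proof.
split=> [H e e0|H i _]; last by have [K hK] := H i.+1%:R^-1 ltac:(by rewrite invr_gt0); exists K.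
have [K _ hK] := H (Num.truncn e^-1) Logic.I.
exists K => j k Kj Kk; apply: le_trans (hK j k Kj Kk) _; apply: ltW.
by rewrite invf_plt ?posrE ?ltr0n// truncnS_gt.
Qed.

Lemma measurable_cauchy_event v : measurable (cauchy_event v).
Proof. by apply: bigcapT_measurable => i; exact: measurable_eventually_steady. Qed.

Lemma Pr_cauchy_event v : Pr P (cauchy_event v) = 0.
Proof.
set p := Pr P _; apply/eqP; rewrite eq_le Pr_ge0 andbT leNgt; apply/negP => p0.
(* Four errors of at most [p / 10] will be added: [M%:R^-1], the [del] of [rarely_close], and one
   bad event for each of the two vertices. Their sum is below [p]. *)
have p10 : 0 < p / 10 by rewrite divr_gt0.
pose M := (Num.truncn (p / 10)^-1).+1.
have MR : 0 < M%:R^-1 :> R by rewrite invr_gt0.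
have Mp : M%:R^-1 < p / 10 by rewrite invf_plt ?posrE ?ltr0n// truncnS_gt.
(* From time [K] at [v] to a late time, across to [v + n], and back to time [K] costs [3 * e], which
   must stay below [M%:R^-1]. *)
pose e : R := M%:R^-1 / 4.
have e0 : 0 < e by rewrite divr_gt0.
have [K HK] := uniform_steady heta heta0 e v p10.
have e3 : e + e + e < M%:R^-1 by rewrite /e; lra.
have [n Hn] := rarely_close heta heta0 K v (ltn0Sn _ : (0 < M)%N) e3 p10.
have [Z [mZ PZ] HZ] := ae_null (chain_close v n).
pose bad u := eventually_steady eta e u `\` [set w | steady K e (Y u w)].
have mbad u : measurable (bad u).
  apply: measurableD; first exact: measurable_eventually_steady.
  exact: measurable_steady.
pose C := [set w | circle_norm (Y v w K - Y (v + n%:Z) w K) <= e + e + e].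
have mC : measurable C.
  by apply: measurable_circle_norm_le; apply: measurable_funB; exact: measurable_eta.
have : p <= Pr P C + Pr P (Z `|` (bad v `|` bad (v + n%:Z))).
  apply: Pr_approx => //; first exact: measurable_cauchy_event.
    by apply: measurableU => //; exact: measurableU.
  move=> w /cauchy_eventP cw /not_orP[nZ /not_orP[b1 b2]].
  have [cn close] := HZ w nZ cw.
  have s1 : steady K e (Y v w).
    apply: contrapT => ns; apply: b1; split => //.
    by have [K' h] := cw e e0; exists K'.
  have s2 : steady K e (Y (v + n%:Z) w).
    apply: contrapT => ns; apply: b2; split => //.
    by have [K' h] := cn e e0; exists K'.
  have [K' hK'] := close e e0; pose k := maxn K K'.
  have kK : (K <= k)%N by rewrite leq_maxl.
  have := hK' k (leq_maxr _ _); have := s1 K k (leqnn K) kK; have := s2 k K kK (leqnn K).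
  rewrite /C /=.
  have := circle_norm_triangle (Y v w k) (Y v w K) (Y (v + n%:Z) w K).
  have := circle_norm_triangle (Y (v + n%:Z) w k) (Y v w k) (Y (v + n%:Z) w K).
  lra.
have := PrU_le P mZ (measurableU _ _ (mbad v) (mbad (v + n%:Z))).
have := PrU_le P (mbad v) (mbad (v + n%:Z)).
have := HK v; have := HK (v + n%:Z); rewrite -!/(bad _) PZ.
move: Hn; rewrite -/C; lra.
Qed.

End consensus.

Theorem corollary5p3 (R : realType) (d : measure_display)
    (T : measurableType d) (P : probability T R) (mu : R)
    (hmu : 0 < mu <= 2^-1)
    (N : int -> R -> {RV P >-> nat}) (coin : int -> nat -> {RV P >-> bool})
    (eta : R -> int -> {RV P >-> R})
    (heta : compass_model mu N coin eta)
    (heta0 : iid_uniform (eta 0)) (v : int) :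
  P.-negligible
    [set w | exists l : R, circle_cvg +oo (fun t => eta t v w) l].
Proof.
exists (cauchy_event eta v); split.
- exact: measurable_cauchy_event.
- rewrite PrE; last exact: measurable_cauchy_event.
  by rewrite (Pr_cauchy_event hmu heta heta0).
(* Convergence in continuous time restricts to integer times, where it implies the Cauchy
   property. *)
move=> w [l [l1 cvl]]; apply/cauchy_eventP => e e0.
have e2 : 0 < e / 2 by rewrite divr_gt0.
have /cvgr_lt /(_ _ e2) [M [_ HM]] := cvl.
exists (Num.truncn `|M|).+1 => j k.
have H i : (Num.truncn `|M| < i)%N -> circle_norm (eta i%:R v w - l) < e / 2.
  move=> Mi; have := HM i%:R; rewrite circle_distE//; last first.
    by apply: (compass_state heta).
  apply; apply: (le_lt_trans (ler_norm M)); apply: (lt_le_trans (truncnS_gt _)).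
  by rewrite ler_nat.
move=> /H hj /H hk.
have := circle_norm_triangle l (eta j%:R v w) (eta k%:R v w).
by rewrite (circle_normC l); lra.
Qed.
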